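(* Let $n\ge1$ be an integer and set $$g(z)=\prod_{j=1}^{\infty}(1+e^{-j}z),\qquad \boldsymbol f=(1,z,\ldots,z^{n-1},g).$$ Then $\boldsymbol f$ represents a transcendental linearly non-degenerate holomorphic curve $\mathbb{C}\to\mathbb{P}^n$ of order zero, and $$\lim_{r\to\infty}\frac{N_1(r,\boldsymbol f)}{T(r,\boldsymbol f)}=1.$$
   Context: A holomorphic curve $f\colon\mathbb{C}\to\mathbb{P}^n$ is represented by a vector $\boldsymbol f=(f_0,\ldots,f_n)$ of entire functions with no common zeros (a reduced representation), $f=[\boldsymbol f]$. It is linearly non-degenerate if $f_0,\ldots,f_n$ are linearly independent over $\mathbb{C}$. It is rational if it extends holomorphically to $\mathbb{P}^1$ (equivalently, has a representation with polynomial coordinates), and transcendental otherwise. The characteristic is $T(r,\boldsymbol f)=\frac1{2\pi}\int_{-\pi}^{\pi}\log\|\boldsymbol f(re^{it})\|\,dt-\log\|\boldsymbol f(0)\|$ with $\|\cdot\|$ the Euclidean norm, and the order of the curve is $\limsup_{r\to\infty}\frac{\log T(r,\boldsymbol f)}{\log r}$. The Wronskian is $W_{\boldsymbol f}=\det\bigl(f_j^{(i)}\bigr)_{0\le i,j\le n}$. If $n_1(r)$ is the number of zeros of $W_{\boldsymbol f}$ in $|z|\le r$, with multiplicity, then $N_1(r,\boldsymbol f)=\int_0^r\bigl(n_1(t)-n_1(0)\bigr)\frac{dt}{t}+n_1(0)\log r$. *)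

(* Defs.v *)
From HB Require Import structures.
From mathcomp Require Import all_boot all_order all_algebra.
From mathcomp Require Import all_classical all_reals all_analysis.
From mathcomp Require Import complex.

Set Implicit Arguments.
Unset Strict Implicit.
Unset Printing Implicit Defensive.

Import Order.TTheory GRing.Theory Num.Theory.
Import numFieldNormedType.Exports.

Local Open Scope classical_set_scope.
Local Open Scope ring_scope.
Local Open Scope complex_scope.

(* R[i] packed as a numClosedFieldType: this is what gives it the topology and
   the normed-module structure over itself, so that [derivable h z 1] and
   [h^`(k)] on CC R -> CC R are complex differentiation. *)
Definition CC (R : realType) : numClosedFieldType := R[i].

Section HolomorphicCurves.
Variable R : realType.
Local Notation C := (CC R).

(* The library norm `|z| on C takes its values in C; this one is real. *)
Definition cabs (z : C) : R := complex.Re `|z|.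

Definition polar (r t : R) : C := (r * cos t) +i* (r * sin t).

Definition entire (h : C -> C) : Prop := forall z : C, derivable h z 1.

Definition order_at (h : C -> C) (z : C) : nat :=
  xget 0%N [set k | (forall i, (i < k)%N -> derive1n i h z = 0) /\
                    derive1n k h z != 0].

(* Number of zeros in the closed disc of radius r, with multiplicity; it is a
   finitely supported sum, hence meaningful for entire h not identically 0. *)
Definition zero_count (h : C -> C) (r : R) : nat :=
  \sum_(z \in [set z : C | cabs z <= r /\ h z = 0]) order_at h z.

Section Curve.
Variables (n : nat) (f : 'I_n.+1 -> C -> C).

Definition reduced_representation : Prop :=
  (forall j, entire (f j)) /\ (forall z, exists j, f j z != 0).

Definition linearly_nondegenerate : Prop :=
  forall c : 'I_n.+1 -> C,
    (forall z, \sum_j c j * f j z = 0) -> forall j, c j = 0.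

(* Holomorphic extension of [f] to infinity, in the chart w = 1/z: near w = 0
   a map to P^n is holomorphic iff it lifts to a holomorphic vector h without
   common zeros, and it extends [f] iff [h w] = [f (1/w)] for w != 0. *)
Definition rational_curve : Prop :=
  exists (e : R) (h : 'I_n.+1 -> C -> C),
    [/\ 0 < e,
        forall j w, cabs w < e -> derivable (h j) w 1,
        forall w, cabs w < e -> exists j, h j w != 0
      & forall w, 0 < cabs w -> cabs w < e ->
          exists2 c : C, c != 0 & forall j, h j w = c * f j w^-1].

Definition transcendental_curve : Prop := ~ rational_curve.

Definition enorm (z : C) : R := Num.sqrt (\sum_j cabs (f j z) ^+ 2).

Definition characteristic (r : R) : R :=
  (2 * pi)^-1 *
    (\int[lebesgue_measure]_(t in `[- pi, pi]) ln (enorm (polar r t)))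
  - ln (enorm 0).

Definition curve_order : \bar R :=
  limf_esup (fun r : R => (ln (characteristic r) / ln r)%:E) (pinfty_nbhs R).

Definition wronskian (z : C) : C :=
  \det (\matrix_(i < n.+1, j < n.+1) derive1n i (f j) z).

Definition N1 (r : R) : R :=
  \int[lebesgue_measure]_(t in `[0, r])
    (((zero_count wronskian t)%:R - (zero_count wronskian 0)%:R) / t)
  + (zero_count wronskian 0)%:R * ln r.

End Curve.

Definition gprod (z : C) : C :=
  limn (fun N => \prod_(1 <= j < N.+1) (1 + ((expR (- j%:R))%:C : C) * z)).

Definition gcurve (n : nat) (j : 'I_n.+1) : C -> C :=
  if (j < n)%N then fun z => z ^+ j else gprod.

End HolomorphicCurves.

(* Main.v *)
Require Import Defs.
From HB Require Import structures.
From mathcomp Require Import all_boot all_order all_algebra.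
From mathcomp Require Import all_classical all_reals all_analysis.
From mathcomp Require Import measurable_realfun complex polyrcf cauchyreals.
From mathcomp Require Import ring lra zify.

Set Implicit Arguments.
Unset Strict Implicit.
Unset Printing Implicit Defensive.

Import Order.TTheory GRing.Theory Num.Theory.
Import numFieldNormedType.Exports.

Local Open Scope classical_set_scope.
Local Open Scope ring_scope.

(** Both [N1] and the characteristic are asymptotic to [(ln r)^2 / 2].

    The first [n] columns of the Wronskian are those of the monomials, so it is
    triangular and equal to a nonzero constant times the [n]-th derivative of
    the product [g] ([wronskianE]). The zeros of [g] are the [-e^(k+1)], negative
    and simple. By Rolle's theorem the roots of the successive derivatives of the
    partial products interlace. In the limit the interlacing survives, because a
    lower bound for products with one factor deleted ([deleted_prod_lb]) shows
    that no zeros other than limits of roots appear and that no two of them merge.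
    So the [n]-th derivative has simple zeros [-b k], with [b k] between
    [e^(k+1)] and [e^(k+1+n)] ([zeros_gder]). The counting function is therefore
    [ln t + O(1)], and integrating it against [dt / t] yields
    [N1 = (ln r)^2 / 2 + O(ln r)] ([N1_bounds]).

    On the circle of radius [r] the factors with [j <= ln r] have modulus
    comparable to [r e^(-j)] and the others multiply to a bounded quantity, so
    [ln |g|] is at most [(ln r)^2 / 2 + O(ln r)] ([g_growth_le]). The same bound
    holds from below off a sector around the negative axis, since there
    [|1 + a z| >= kappa max (1, a r)] ([sector_factor_lb], [g_growth_ge]). As the
    logarithm of the norm is nonnegative on the removed sector, whose angle is
    arbitrarily small, the characteristic is [(ln r)^2 / 2 (1 + o(1))]
    ([characteristic_bounds]). This gives the order and the limit.

    The partial products have nonnegative coefficients, increasing with the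
    number of factors. Values at complex points are then controlled by values at
    real points, and this alone gives convergence of all derivatives and their
    differentiability ([polylim_cvg], [polylim_taylor]). Transcendence and
    nondegeneracy use only the zeros of [g] and its superpolynomial growth on
    the positive axis. *)

(** * The modulus and convergence in the complex numbers *)

(** The codomain is the packed [CC R], where the field, order and topological
    structures live, so that morphism lemmas rewrite there. *)
Definition ofR (R : realType) (x : R) : CC R := Complex x 0.

Section RealEmbedding.
Variable R : realType.

Fact ofR_is_additive : zmod_morphism (@ofR R).
Proof. by move=> x y; apply: (rmorphB (real_complex R)). Qed.

Fact ofR_is_multiplicative : monoid_morphism (@ofR R).
Proof. by split=> // x y; apply: (rmorphM (real_complex R)). Qed.

HB.instance Definition _ := GRing.isZmodMorphism.Build R (CC R) (@ofR R) ofR_is_additive.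
HB.instance Definition _ :=
  GRing.isMonoidMorphism.Build R (CC R) (@ofR R) ofR_is_multiplicative.
End RealEmbedding.

Section ComplexAbs.
Variable R : realType.
Local Notation C := (CC R).
Implicit Types (x y : R) (z w : C).

Lemma cabsE z : cabs z = Num.sqrt (complex.Re z ^+ 2 + complex.Im z ^+ 2).
Proof. by case: z. Qed.

Lemma normC_cabs z : `|z| = ofR (cabs z).
Proof. by case: z. Qed.

Lemma ofR_inj : injective (@ofR R). Proof. by move=> x y []. Qed.

Lemma ofR_le x y : (ofR x <= ofR y) = (x <= y).
Proof. exact: lecR. Qed.

Lemma ofR_lt x y : (ofR x < ofR y) = (x < y).
Proof. exact: ltcR. Qed.

Lemma cabs_ge0 z : 0 <= cabs z.
Proof. by rewrite cabsE sqrtr_ge0. Qed.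

Lemma cabsM z w : cabs (z * w) = cabs z * cabs w.
Proof. by apply: ofR_inj; rewrite rmorphM -!normC_cabs; exact: normrM. Qed.

Lemma cabsD z w : cabs (z + w) <= cabs z + cabs w.
Proof. by rewrite -ofR_le rmorphD -!normC_cabs ler_normD. Qed.

Lemma cabsN z : cabs (- z) = cabs z.
Proof. by apply: ofR_inj; rewrite -!normC_cabs normrN. Qed.

Lemma cabs_ofR x : cabs (ofR x) = `|x|.
Proof. by rewrite cabsE /= expr0n addr0 sqrtr_sqr. Qed.

Lemma cabs0 : cabs (0 : C) = 0.
Proof. by rewrite -(rmorph0 (@ofR R)) cabs_ofR normr0. Qed.

Lemma cabs1 : cabs (1 : C) = 1.
Proof. by rewrite -(rmorph1 (@ofR R)) cabs_ofR normr1. Qed.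

Lemma cabs_eq0 z : (cabs z == 0) = (z == 0).
Proof. by rewrite -[z == 0]normr_eq0 normC_cabs -(inj_eq ofR_inj) rmorph0. Qed.

Lemma cabs_gt0 z : (0 < cabs z) = (z != 0).
Proof. by rewrite lt0r cabs_ge0 andbT cabs_eq0. Qed.

Lemma cabsX z n : cabs (z ^+ n) = cabs z ^+ n.
Proof. by elim: n => [|n IH]; rewrite ?cabs1 // !exprS cabsM IH. Qed.

Lemma cabsV z : cabs z^-1 = (cabs z)^-1.
Proof. by apply: ofR_inj; rewrite fmorphV -!normC_cabs normfV. Qed.

Lemma cabs_prod (I : Type) (s : seq I) (P : pred I) (F : I -> C) :
  cabs (\prod_(i <- s | P i) F i) = \prod_(i <- s | P i) cabs (F i).
Proof. exact: (big_morph _ cabsM cabs1). Qed.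

Lemma cabsB_le z w : cabs z - cabs w <= cabs (z - w).
Proof. by rewrite lerBlDr; apply: le_trans (cabsD _ _); rewrite subrK. Qed.

Lemma cabs_dist_le z w : `|cabs z - cabs w| <= cabs (z - w).
Proof.
rewrite ler_norml cabsB_le andbT lerNl opprB.
by rewrite -(cabsN (z - w)) opprB cabsB_le.
Qed.

Lemma cabs_Re z : `|complex.Re z| <= cabs z.
Proof. by rewrite -ofR_le -normC_cabs; exact: normc_ge_Re. Qed.

Lemma cabs_Im z : `|complex.Im z| <= cabs z.
Proof.
rewrite cabsE -(sqrtr_sqr (complex.Im z)) ler_wsqrtr //.
by rewrite lerDr sqr_ge0.
Qed.

Lemma cabs_ReIm z : cabs z <= `|complex.Re z| + `|complex.Im z|.
Proof.
rewrite cabsE -[leRHS]ger0_norm ?addr_ge0 // -[leRHS]sqrtr_sqr ler_wsqrtr //.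
rewrite sqrrD !real_normK ?num_real // -addrA lerD2l lerDr.
by rewrite mulrn_wge0 // mulr_ge0.
Qed.

Lemma gt0_ofR (e : C) : 0 < e -> exists2 x, 0 < x & e = ofR x.
Proof.
case: e => a b; rewrite ltcE => /= /andP[/eqP b0 a0].
by exists a => //; rewrite /ofR b0.
Qed.

(** Limits in [C] become limits in [R], where the order is total and squeezing
    is available. *)
Lemma cvgC_cabs (T : Type) (F : set_system T) (FF : Filter F) (u : T -> C) (l : C) :
  u @ F --> l <-> cabs (u t - l) @[t --> F] --> (0 : R).
Proof.
split=> [/cvgrPdist_lt h|/cvgrPdist_lt h].
  apply/cvgrPdist_lt => e e0.
  have /h : 0 < ofR e by rewrite -(rmorph0 (@ofR R)) ofR_lt.
  apply: filterS => t; rewrite normC_cabs ofR_lt => ht.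
  by rewrite sub0r normrN ger0_norm ?cabs_ge0 // -cabsN opprB.
apply/cvgrPdist_lt => _ /gt0_ofR[e e0 ->].
apply: filterS (h _ e0) => t.
rewrite sub0r normrN ger0_norm ?cabs_ge0 // => ht.
by rewrite normC_cabs ofR_lt -cabsN opprB.
Qed.

Lemma cvg_cabs (T : Type) (F : set_system T) (FF : Filter F) (u : T -> C) (l : C) :
  u @ F --> l -> cabs (u t) @[t --> F] --> cabs l.
Proof.
move=> /cvgC_cabs/cvgrPdist_lt h; apply/cvgrPdist_lt => e /h.
apply: filterS => t; rewrite sub0r normrN ger0_norm ?cabs_ge0 // => ht.
by apply: le_lt_trans ht; rewrite distrC cabs_dist_le.
Qed.

Lemma cvg_abs_sub (T : Type) (F : set_system T) (FF : Filter F) (u : T -> R) (l : R) :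
  u @ F --> l -> `|u t - l| @[t --> F] --> (0 : R).
Proof.
move=> /cvgrPdist_lt h; apply/cvgrPdist_lt => e /h.
by apply: filterS => t; rewrite sub0r normrN normr_id distrC.
Qed.

Lemma cvg_ofR (T : Type) (F : set_system T) (FF : Filter F) (u : T -> R) (l : R) :
  u @ F --> l -> ofR (u t) @[t --> F] --> ofR l.
Proof.
move=> h; apply/cvgC_cabs; under eq_fun do rewrite -rmorphB cabs_ofR.
exact: cvg_abs_sub.
Qed.

(** The real and the imaginary part of [u] become nondecreasing and bounded once
    [x] is added to them. *)
Lemma cauchyC_cvg (u : nat -> C) (x : nat -> R) :
  cvgn x -> (forall M N, (N <= M)%N -> cabs (u M - u N) <= x M - x N) ->
  cvgn u.
Proof.
move=> cx hx.
have nx : nondecreasing_seq x.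
  by move=> N M NM; rewrite -subr_ge0; apply: le_trans (hx _ _ NM); exact: cabs_ge0.
have key (v : nat -> R) :
    (forall M N, (N <= M)%N -> `|v M - v N| <= cabs (u M - u N)) -> cvgn v.
  move=> hv; pose y N := v N + x N.
  have hvx M N : (N <= M)%N -> `|v M - v N| <= x M - x N.
    by move=> NM; apply: le_trans (hv _ _ NM) (hx _ _ NM).
  have ny : nondecreasing_seq y.
    by move=> N M /hvx; rewrite ler_norml /y => /andP[h _]; lra.
  have cy : cvgn y.
    apply: nondecreasing_is_cvgn => //; exists (v 0%N - x 0%N + 2 * limn x) => _ [N _ <-].
    have := hvx N 0%N (leq0n _); have := nondecreasing_cvgn_le nx cx N.
    by rewrite ler_norml /y => h1 /andP[_ h2]; lra.
  have -> : v = (fun N => y N - x N) by apply/funext => N; rewrite /y addrK.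
  exact: is_cvgB.
have cRe : cvgn (fun N => complex.Re (u N)).
  apply: key => M N _ /=; apply: le_trans (cabs_Re (u M - u N)).
  by case: (u M) (u N) => a b [c d].
have cIm : cvgn (fun N => complex.Im (u N)).
  apply: key => M N _ /=; apply: le_trans (cabs_Im (u M - u N)).
  by case: (u M) (u N) => a b [c d].
apply/cvg_ex.
exists (Complex (limn (fun N => complex.Re (u N))) (limn (fun N => complex.Im (u N)))).
apply/cvgC_cabs.
have h0 : `|complex.Re (u N) - limn (fun N => complex.Re (u N))| +
   `|complex.Im (u N) - limn (fun N => complex.Im (u N))| @[N --> \oo] --> 0.
  rewrite -[X in _ --> X](addr0 0); apply: cvgD.
    exact: cvg_abs_sub.
  exact: cvg_abs_sub.
apply: (squeeze_cvgr _ (cvg_cst 0) h0).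
apply: nearW => N; rewrite cabs_ge0 /=.
apply: le_trans (cabs_ReIm _) _.
by case: (u N).
Qed.
End ComplexAbs.

(** * Polynomials with nonnegative coefficients and their increasing limits *)

Local Notation nneg := (polyOver Num.nneg).
Local Notation pC p := (map_poly (@ofR _) p).

Section NonnegativePoly.
Variable R : realType.
Local Notation C := (CC R).
Implicit Types (p q : {poly R}) (x y : R) (z h : C).

Lemma nnegM p q : p \is a nneg -> q \is a nneg -> p * q \is a nneg.
Proof. by move=> hp hq; apply: polyOver_mulr_2closed. Qed.

Lemma nnegD p q : p \is a nneg -> q \is a nneg -> p + q \is a nneg.
Proof.
move=> /polyOverP hp /polyOverP hq; apply/polyOverP => i.
by have := addr_ge0 (hp i) (hq i); rewrite coefD nnegrE.
Qed.

Lemma nneg_cons p c : p * 'X + c%:P \is a nneg -> p \is a nneg.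
Proof.
move=> /polyOverP hp; apply/polyOverP => i.
by have := hp i.+1; rewrite coefD coefMX coefC /= addr0.
Qed.

Lemma nneg_horner_ge0 p x : p \is a nneg -> 0 <= x -> 0 <= p.[x].
Proof. by move=> hp x0; have := rpred_horner hp (x0 : x \in Num.nneg). Qed.

Lemma nneg_horner_le p x y : p \is a nneg -> 0 <= x -> x <= y -> p.[x] <= p.[y].
Proof.
elim/poly_ind: p => [|p c IH] hp x0 xy; first by rewrite !horner0.
have hp' := nneg_cons hp.
rewrite !hornerMXaddC lerD2r ler_pM ?nneg_horner_ge0 //; exact: IH.
Qed.

Lemma pCMXaddC p c z : (pC (p * 'X + c%:P)).[z] = (pC p).[z] * z + ofR c.
Proof. by rewrite rmorphD rmorphM /= map_polyX map_polyC /= hornerMXaddC. Qed.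

Lemma cabs_horner_le p z : p \is a nneg -> cabs (pC p).[z] <= p.[cabs z].
Proof.
elim/poly_ind: p => [|p c IH] hp; first by rewrite rmorph0 !horner0 cabs0.
have c0 : 0 <= c by have /polyOverP/(_ 0%N) := hp; rewrite coefD coefMX coefC add0r.
rewrite pCMXaddC hornerMXaddC; apply: le_trans (cabsD _ _) _.
by rewrite cabsM cabs_ofR ger0_norm // lerD2r ler_wpM2r ?cabs_ge0 ?IH // (nneg_cons hp).
Qed.

(** Horner induction: with nonnegative coefficients every term is largest at the
    real point [cabs z + cabs h]. *)
Lemma cabs_horner_diff p z h : p \is a nneg ->
  cabs ((pC p).[z + h] - (pC p).[z]) <= cabs h * p^`().[cabs z + cabs h].
Proof.
elim/poly_ind: p => [|p c IH] hp.
  by rewrite rmorph0 !horner0 subr0 cabs0 linear0 horner0 mulr0.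
have {}hp := nneg_cons hp.
have a0 := cabs_ge0 z; have b0 := cabs_ge0 h.
rewrite !pCMXaddC derivD derivC addr0 derivM derivX mulr1 hornerD hornerM hornerX.
set X := cabs z + cabs h.
rewrite [X in cabs X](_ : _ = ((pC p).[z + h] - (pC p).[z]) * z + (pC p).[z + h] * h);
  last by ring.
apply: le_trans (cabsD _ _) _; rewrite !cabsM.
have hX : cabs (pC p).[z + h] <= p.[X].
  apply: le_trans (cabs_horner_le _ hp) _.
  by apply: nneg_horner_le; rewrite ?cabs_ge0 ?cabsD.
have d0 : 0 <= p^`().[X].
  by apply: nneg_horner_ge0; [exact: polyOver_deriv|exact: addr_ge0].
apply: le_trans (lerD (ler_wpM2r a0 (IH hp)) (ler_wpM2r b0 hX)) _.
rewrite -/X -subr_ge0.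
have <- : cabs h * p^`().[X] * cabs h =
  cabs h * (p^`().[X] * X + p.[X]) - (cabs h * p^`().[X] * cabs z + p.[X] * cabs h).
  by rewrite {3}/X; ring.
by rewrite !mulr_ge0.
Qed.

Lemma cabs_horner_taylor p z h : p \is a nneg ->
  cabs ((pC p).[z + h] - (pC p).[z] - h * (pC p^`()).[z])
    <= cabs h ^+ 2 * p^`(2).[cabs z + cabs h].
Proof.
elim/poly_ind: p => [|p c IH] hp.
  by rewrite derivnS /= !deriv0 !rmorph0 !horner0 !(mulr0, subr0) cabs0.
have {}hp := nneg_cons hp.
have a0 := cabs_ge0 z; have b0 := cabs_ge0 h.
have -> : pC (p * 'X + c%:P)^`() = pC p^`() * 'X + pC p.
  by rewrite derivD derivC addr0 derivM derivX mulr1 rmorphD rmorphM /= map_polyX.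
rewrite !pCMXaddC hornerD hornerM hornerX.
set X := cabs z + cabs h.
have -> : (p * 'X + c%:P)^`(2).[X] = p^`(2).[X] * X + p^`().[X] + p^`().[X].
  by rewrite !derivSn !derivn0 derivD derivC addr0 !(derivM, derivD, derivX, mulr1) !hornerE; ring.
rewrite [X in cabs X](_ : _ = ((pC p).[z + h] - (pC p).[z] - h * (pC p^`()).[z]) * z
    + ((pC p).[z + h] - (pC p).[z]) * h); last by ring.
apply: le_trans (cabsD _ _) _; rewrite !cabsM.
have d0 : 0 <= p^`().[X].
  by apply: nneg_horner_ge0; [exact: polyOver_deriv|exact: addr_ge0].
have d1 : 0 <= p^`(2).[X].
  by apply: nneg_horner_ge0; [exact: polyOver_derivn|exact: addr_ge0].
apply: le_trans (lerD (ler_wpM2r a0 (IH hp)) (ler_wpM2r b0 (cabs_horner_diff z h hp))) _.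
rewrite -/X -subr_ge0.
have <- : cabs h ^+ 2 * (p^`(2).[X] * cabs h + p^`().[X]) =
  cabs h ^+ 2 * (p^`(2).[X] * X + p^`().[X] + p^`().[X]) -
  (cabs h ^+ 2 * p^`(2).[X] * cabs z + cabs h * p^`().[X] * cabs h).
  by rewrite {4}/X; ring.
by rewrite mulr_ge0 ?exprn_ge0 // addr_ge0 // mulr_ge0.
Qed.

(** Taylor's formula at [x], evaluated at [x + 1], has nonnegative terms. *)
Lemma nneg_derivn_le p m x : p \is a nneg -> 0 <= x ->
  p^`(m).[x] <= m`!%:R * p.[x + 1].
Proof.
move=> hp x0; have hN i : 0 <= p^`N(i).[x].
  by apply: nneg_horner_ge0 => //; exact: polyOver_nderivn.
rewrite nderivn_def hornerMn -mulr_natl ler_wpM2l //.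
rewrite nderiv_taylor; last exact: mulrC.
under eq_bigr do rewrite expr1n mulr1.
case: (ltnP m (size p)) => hm.
  rewrite (bigD1 (Ordinal hm)) //= lerDl; apply: sumr_ge0 => i _; exact: hN.
by rewrite nderivn_poly0 // horner0; apply: sumr_ge0 => i _; exact: hN.
Qed.
End NonnegativePoly.

Section IncreasingLimit.
Variable R : realType.
Local Notation C := (CC R).
Variable P : nat -> {poly R}.
Hypothesis P_nneg : forall N, P N \is a nneg.
Hypothesis P_mono : forall N M, (N <= M)%N -> P M - P N \is a nneg.
Hypothesis P_bnd : forall x, 0 <= x -> exists B, forall N, (P N).[x] <= B.
Implicit Types (x : R) (z h : C).

(** The derivatives of the limit are defined as limits of derivatives, which
    treats all orders alike; [polylim_is_derive] shows that they are derivatives. *)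
Definition polylim (m : nat) (z : C) : C := limn (fun N => (pC (P N)^`(m)).[z]).

Lemma P_derivn_nneg m N : (P N)^`(m) \is a nneg.
Proof. exact: polyOver_derivn. Qed.

Lemma P_derivn_bnd m x : 0 <= x -> exists2 B, 0 <= B & forall N, (P N)^`(m).[x] <= B.
Proof.
move=> x0; have [|B hB] := P_bnd (x := x + 1); first exact: addr_ge0.
exists (m`!%:R * B) => [|N].
  rewrite mulr_ge0 //; apply: le_trans (hB 0%N).
  by apply: nneg_horner_ge0 => //; exact: addr_ge0.
by apply: le_trans (nneg_derivn_le _ (P_nneg N) x0) _; rewrite ler_wpM2l.
Qed.

Lemma P_derivn_mono m x N M : 0 <= x -> (N <= M)%N ->
  (P N)^`(m).[x] <= (P M)^`(m).[x].
Proof.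
move=> x0 NM; rewrite -subr_ge0 -hornerN -hornerD -derivnN -derivnD.
by apply: nneg_horner_ge0 => //; exact/polyOver_derivn/P_mono.
Qed.

(** The increments at [z] are bounded by those at the real point [cabs z], which
    telescope. *)
Lemma polylim_cvg m z : (pC (P N)^`(m)).[z] @[N --> \oo] --> polylim m z.
Proof.
apply: (@cauchyC_cvg _ _ (fun N => (P N)^`(m).[cabs z])).
  have [B _ hB] := P_derivn_bnd m (cabs_ge0 z).
  apply: nondecreasing_is_cvgn; last by exists B => _ [N _ <-].
  by move=> N M; apply: P_derivn_mono; exact: cabs_ge0.
move=> M N NM; rewrite -hornerN -hornerD -rmorphB -derivnB.
rewrite -[in leRHS]hornerN -hornerD -derivnN -derivnD.
by apply: cabs_horner_le; exact/polyOver_derivn/P_mono.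
Qed.

(** The quadratic Taylor bound is uniform in [N], hence survives the limit. *)
Lemma polylim_taylor m z : exists2 B, 0 <= B & forall h, cabs h <= 1 ->
  cabs (polylim m (z + h) - polylim m z - h * polylim m.+1 z) <= cabs h ^+ 2 * B.
Proof.
have z0 := cabs_ge0 z.
have [|B B0 hB] := P_derivn_bnd m.+2 (x := cabs z + 1); first exact: addr_ge0.
exists B => // h h1.
have : cabs ((pC (P N)^`(m)).[z + h] - (pC (P N)^`(m)).[z] - h * (pC (P N)^`(m.+1)).[z])
    @[N --> \oo] --> cabs (polylim m (z + h) - polylim m z - h * polylim m.+1 z).
  apply: cvg_cabs; apply: cvgB; last by apply: cvgM; [exact: cvg_cst|exact: polylim_cvg].
  by apply: cvgB; exact: polylim_cvg.
move/cvgr_to_le; apply; apply: nearW => N.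
rewrite derivnS; apply: le_trans (cabs_horner_taylor z h (P_derivn_nneg m N)) _.
rewrite ler_wpM2l ?exprn_ge0 ?cabs_ge0 //.
rewrite -[(P N)^`(m)^`(2)]/((P N)^`(m.+2)).
apply: le_trans (hB N); apply: nneg_horner_le; rewrite ?addr_ge0 ?cabs_ge0 //.
  exact: P_derivn_nneg.
by rewrite lerD2l.
Qed.

Lemma polylim_is_derive m z : is_derive z 1 (polylim m) (polylim m.+1 z).
Proof.
have [B B0 hB] := polylim_taylor m z.
suff h : h^-1 *: ((polylim m \o shift z) (h *: 1) - polylim m z)
    @[h --> 0^'] --> polylim m.+1 z.
  by apply: DeriveDef; [apply/cvg_ex; exists (polylim m.+1 z)|apply: cvg_lim].
apply/cvgrPdist_le => _ /gt0_ofR[e e0 ->].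
near=> h.
have hn0 : h != 0 by near: h; exact: nbhs_dnbhs_neq.
have hh : cabs h <= Num.min 1 (e / (B + 1)).
  rewrite -ofR_le -normC_cabs; near: h; apply: dnbhs0_le.
  by rewrite -(rmorph0 (@ofR R)) ofR_lt lt_min ltr01 divr_gt0 // ltr_wpDl.
move: hh; rewrite le_min => /andP[h1 h2].
rewrite normC_cabs ofR_le /= -cabsN opprB.
have -> : h^-1 *: (polylim m (h *: 1 + z) - polylim m z) - polylim m.+1 z =
   h^-1 * (polylim m (z + h) - polylim m z - h * polylim m.+1 z).
  rewrite (_ : h *: 1 + z = z + h); last by rewrite addrC; congr (_ + _); exact: mulr1.
  rewrite -[h^-1 *: _]/(h^-1 * (polylim m (z + h) - polylim m z)).
  by rewrite [RHS]mulrBr [in RHS]mulrA mulVf // mul1r.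
rewrite cabsM cabsV ler_pdivrMl ?cabs_gt0 //.
apply: le_trans (hB _ h1) _; rewrite expr2 -mulrA ler_wpM2l ?cabs_ge0 //.
move: h2; rewrite ler_pdivlMr ?ltr_wpDl //; have := cabs_ge0 h; nra.
Unshelve. all: by end_near. Qed.

Lemma polylim_derive1 m : derive1 (polylim m) = polylim m.+1.
Proof. by apply/funext => z; rewrite derive1E; have [_ ->] := polylim_is_derive m z. Qed.

Lemma polylim_derive1n m k : derive1n k (polylim m) = polylim (m + k).
Proof. by elim: k => [|k IH]; rewrite ?addn0 // derive1nS IH polylim_derive1 addnS. Qed.

Lemma polylim_continuous m : continuous (polylim m).
Proof.
move=> z; apply: differentiable_continuous; apply/derivable1_diffP.
by have [] := polylim_is_derive m z.
Qed.

(** Equicontinuity turns pointwise convergence into continuous convergence. *)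
Lemma polylim_cvg_moving m (F : set_system nat) (FF : ProperFilter F) (w : nat -> C) z :
  F `=>` \oo -> w @ F --> z -> (pC (P N)^`(m)).[w N] @[N --> F] --> polylim m z.
Proof.
move=> Foo wz; have z0 := cabs_ge0 z.
have [|B B0 hB] := P_derivn_bnd m.+1 (x := cabs z + 1); first exact: addr_ge0.
have -> : (fun N => (pC (P N)^`(m)).[w N]) =
   (fun N => ((pC (P N)^`(m)).[w N] - (pC (P N)^`(m)).[z]) + (pC (P N)^`(m)).[z]).
  by apply/funext => N; rewrite subrK.
rewrite -[X in _ --> X]add0r; apply: cvgD; last first.
  by apply: cvg_trans; last exact: polylim_cvg; exact: cvg_app.
apply/cvgC_cabs; under eq_fun do rewrite subr0.
move/cvgC_cabs : wz => wz.
have wB : cabs (w N - z) * B @[N --> F] --> 0.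
  by rewrite -[X in _ --> X](mul0r B); apply: cvgM => //; exact: cvg_cst.
apply: (squeeze_cvgr _ (cvg_cst 0) wB).
have w1 : \forall N \near F, cabs (w N - z) <= 1.
  by apply: (cvgr_le _ wz); exact: ltr01.
apply: filterS w1 => N w1; rewrite cabs_ge0 /=.
have := cabs_horner_diff z (w N - z) (P_derivn_nneg m N).
rewrite [z + _]addrC subrK => /le_trans; apply; rewrite ler_wpM2l ?cabs_ge0 //.
apply: le_trans (hB N); rewrite -derivnS; apply: nneg_horner_le.
- exact: P_derivn_nneg.
- by rewrite addr_ge0 ?cabs_ge0.
- by rewrite lerD2l.
Qed.
End IncreasingLimit.

(** * Auxiliary real analysis *)

Section RealTools.
Variable R : realType.
Implicit Types (x y : R).

Lemma ge2_expR1 : 2 <= expR 1 :> R.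
Proof. by have := expR_ge1Dx (1 : R). Qed.

(** Telescoping: [e >= 2] gives [e^(-j-1) <= e^(-j) - e^(-j-1)]. *)
Lemma sum_expRN_le a b : \sum_(a <= j < b) expR (- j.+1%:R) <= expR (- a%:R) :> R.
Proof.
have [ab|/ltnW ba] := leqP a b; last by rewrite big_geq // expR_ge0.
suff : \sum_(a <= j < b) expR (- j.+1%:R) <= expR (- a%:R) - expR (- b%:R) :> R.
  by move/le_trans; apply; rewrite gerBl expR_ge0.
have -> : expR (- a%:R) - expR (- b%:R) =
    \sum_(a <= j < b) (expR (- j%:R) - expR (- j.+1%:R)) :> R.
  rewrite -[LHS]opprB -(telescope_sumr (fun j => expR (- j%:R))) // -sumrN.
  by apply: eq_bigr => j _; rewrite opprB.
apply: ler_sum => j _; have -> : - j%:R = 1 - j.+1%:R :> R by rewrite -natr1; ring.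
by rewrite expRD; have := expR_gt0 (- j.+1%:R : R); have := ge2_expR1; nra.
Qed.

(** Weierstrass' product inequality. *)
Lemma prod_onem_ge (I : Type) (s : seq I) (P : pred I) (x : I -> R) :
  (forall i, P i -> 0 <= x i <= 1) ->
  1 - \sum_(i <- s | P i) x i <= \prod_(i <- s | P i) (1 - x i).
Proof.
move=> hx; suff : 0 <= \prod_(i <- s | P i) (1 - x i) <= 1 /\
  1 - \sum_(i <- s | P i) x i <= \prod_(i <- s | P i) (1 - x i) by case.
elim: s => [|i s [/andP[h0 h1] IH]]; first by rewrite !big_nil subr0 lexx ler01.
rewrite !big_cons; case: ifP => [/hx/andP[x0 x1]|_]; last by rewrite h0 h1.
split; last by nra.
by rewrite mulr_ge0 ?subr_ge0 //= mulr_ile1 ?subr_ge0 // gerBl.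
Qed.

(** The difference of both sides has degree at most [n] and [n + 1] roots, the
    last of which is [0]. *)
Lemma poly_factor_roots (p : {poly R}) n (b : nat -> R) :
  (size p <= n.+1)%N -> (forall k, (k < n)%N -> 0 < b k) ->
  (forall j k, (j < n)%N -> (k < n)%N -> b j = b k -> j = k) ->
  (forall k, (k < n)%N -> p.[- b k] = 0) ->
  p = p.[0]%:P * \prod_(0 <= k < n) (1 + (b k)^-1%:P * 'X).
Proof.
move=> sp b0 binj bp; apply/eqP; rewrite -subr_eq0; apply/eqP.
set q := \prod_(_ <= _ < _) _.
have hq x : q.[x] = \prod_(0 <= k < n) (1 + (b k)^-1 * x).
  by rewrite horner_prod; apply: eq_bigr => k _; rewrite !hornerE.
have sq : (size q <= n.+1)%N.
  rewrite /q; elim: (n) => [|k IH]; first by rewrite big_geq // size_poly1.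
  rewrite big_nat_recr //=; apply: leq_trans (size_polyMleq _ _) _.
  have : (size (1 + (b k)^-1%:P * 'X : {poly R})%R <= 2)%N.
    apply: leq_trans (size_polyD _ _) _; rewrite size_poly1 geq_max /=.
    apply: leq_trans (size_polyMleq _ _) _; rewrite size_polyX.
    by rewrite addn2 /= ltnS size_polyC_leq1.
  by move=> h; rewrite -subn1 leq_subLR (leq_trans (leq_add IH h)) // addn2 add1n.
apply: (@poly_ltsp_roots _ _ (0 :: [seq - b k | k <- iota 0 n])).
- rewrite /= size_map size_iota; apply: leq_trans (size_polyD _ _) _.
  rewrite size_polyN geq_max sp /=; apply: leq_trans (size_polyMleq _ _) _.
  by rewrite -subn1 leq_subLR (leq_trans (leq_add (size_polyC_leq1 _) sq)).
- rewrite /=; apply/andP; split.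
    apply/mapP => -[k]; rewrite mem_iota add0n => /andP[_ /b0 bk] h.
    by move: bk; rewrite lt0r -oppr_eq0 -h eqxx.
  rewrite map_inj_in_uniq ?iota_uniq // => j k.
  by rewrite !mem_iota !add0n => /andP[_ hj] /andP[_ hk] /oppr_inj; exact: binj.
- rewrite /=; apply/andP; split.
    rewrite rootE hornerD hornerN hornerM hornerC hq.
    by rewrite big1 ?mulr1 ?subrr // => k _; rewrite mulr0 addr0.
  apply/allP => x /mapP[k]; rewrite mem_iota add0n => /andP[_ hk] ->.
  rewrite rootE hornerD hornerN hornerM hornerC hq bp // sub0r oppr_eq0.
  rewrite big_mkord (bigD1 (Ordinal hk)) //= mulrN mulVf ?subrr ?mul0r ?mulr0 //.
  by rewrite gt_eqF // b0.
Qed.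
End RealTools.

Section UltraLimit.
Variable R : realType.

Lemma ultra_fmap (T U : Type) (F : set_system T) (f : T -> U) :
  UltraFilter F -> UltraFilter (f @ F).
Proof.
move=> FU; split; first exact: fmap_proper_filter.
move=> H HP sFH; rewrite eqEsubset; split=> // A HA.
have [//|h] := in_ultra_setVsetC (f @^-1` A) FU.
have : H (~` A) by apply: sFH.
by move=> /(filterI HA); rewrite setICr => /filter_not_empty.
Qed.

(** Along an ultrafilter all bounded sequences converge simultaneously, which
    replaces the extraction of diagonal subsequences. *)
Lemma ultra_bounded_cvg (F : set_system nat) (u : nat -> R) a b :
  UltraFilter F -> (\forall N \near F, a <= u N <= b) ->
  exists l, u @ F --> l /\ a <= l <= b.
Proof.
move=> FU h; have := @segment_compact R a b; rewrite compact_ultra.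
move=> /(_ _ (ultra_fmap u FU)) [|l [/= hl cl]].
  by apply: filterS h => N; rewrite /= in_itv.
by exists l; split => //; move: hl; rewrite in_itv.
Qed.
End UltraLimit.

(** * The partial products and the roots of their derivatives *)

Section Product.
Variable R : realType.
Local Notation C := (CC R).
Implicit Types (x y : R) (z w : C).

Definition gpart N : {poly R} := \prod_(1 <= j < N.+1) (1 + (expR (- j%:R))%:P * 'X).

Lemma gpartS N : gpart N.+1 = gpart N * (1 + (expR (- N.+1%:R))%:P * 'X).
Proof. by rewrite /gpart big_nat_recr. Qed.

Lemma gpart_horner N x : (gpart N).[x] = \prod_(1 <= j < N.+1) (1 + expR (- j%:R) * x).
Proof. by rewrite horner_prod; apply: eq_bigr => j _; rewrite !hornerE. Qed.

Lemma pC_gpart_horner N z :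
  (pC (gpart N)).[z] = \prod_(1 <= j < N.+1) (1 + ofR (expR (- j%:R)) * z).
Proof.
rewrite rmorph_prod horner_prod; apply: eq_bigr => j _.
by rewrite rmorphD rmorphM rmorph1 /= map_polyC map_polyX !hornerE.
Qed.

Lemma gpart_nneg N : gpart N \is a nneg.
Proof.
rewrite /gpart big_add1; elim: N => [|N IH]; first by rewrite big_geq // polyOverC nnegrE.
rewrite big_nat_recr //=; apply: nnegM => //; apply: nnegD; first by rewrite polyOverC nnegrE.
by apply: nnegM; rewrite ?polyOverX // polyOverC nnegrE expR_ge0.
Qed.

Lemma gpart_mono N M : (N <= M)%N -> gpart M - gpart N \is a nneg.
Proof.
elim: M => [|M IH]; first by rewrite leqn0 => /eqP ->; rewrite subrr polyOver0.
rewrite leq_eqVlt => /orP[/eqP ->|/IH h]; first by rewrite subrr polyOver0.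
have -> : gpart M.+1 - gpart N = (gpart M - gpart N) + gpart M * ((expR (- M.+1%:R))%:P * 'X).
  by rewrite gpartS; ring.
apply: nnegD => //; apply: nnegM; first exact: gpart_nneg.
by apply: nnegM; rewrite ?polyOverX // polyOverC nnegrE expR_ge0.
Qed.

Lemma gpart_le_expR N x : 0 <= x -> (gpart N).[x] <= expR x.
Proof.
move=> x0; rewrite gpart_horner.
apply: (@le_trans _ _ (\prod_(1 <= j < N.+1) expR (expR (- j%:R) * x))).
  apply: ler_prod => j _; rewrite expR_ge1Dx andbT.
  by rewrite addr_ge0 // mulr_ge0 // expR_ge0.
rewrite -expR_sum ler_expR -mulr_suml; apply: ler_piMl => //; rewrite big_add1 /=.
by have := sum_expRN_le R 0 N; rewrite oppr0 expR0.
Qed.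

Lemma gpart_bnd x : 0 <= x -> exists B, forall N, (gpart N).[x] <= B.
Proof. by move=> x0; exists (expR x) => N; exact: gpart_le_expR. Qed.

(** By [gprodE] and [polylim_derive1n], [gder m] is the [m]-th derivative of the
    infinite product. *)
Definition gder := polylim gpart.

Lemma gprodE : @gprod R = gder 0.
Proof.
apply/funext => z; rewrite /gder /polylim /gprod; congr (lim (_ @ \oo)).
by apply/funext => N; rewrite derivn0 pC_gpart_horner.
Qed.

Lemma size_gpart_derivn N m : (size (gpart N)^`(m) <= (N - m).+1)%N.
Proof.
have h : (size (gpart N) <= N.+1)%N.
  elim: N => [|N IH]; first by rewrite /gpart big_geq // size_poly1.
  rewrite gpartS; apply: leq_trans (size_polyMleq _ _) _.
  have : (size (1 + (expR (- N.+1%:R))%:P * 'X : {poly R})%R <= 2)%N.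
    apply: leq_trans (size_polyD _ _) _; rewrite size_poly1 geq_max /=.
    apply: leq_trans (size_polyMleq _ _) _; rewrite size_polyX.
    by rewrite addn2 /= ltnS size_polyC_leq1.
  by move=> h'; rewrite -subn1 leq_subLR (leq_trans (leq_add IH h')) // addn2 add1n.
by rewrite size_derivn (leq_trans (leq_sub2r m h)) //; lia.
Qed.

Lemma gpart_coef_gt0 N m : (m <= N)%N -> 0 < (gpart N)`_m.
Proof.
elim: N m => [|N IH] [|m] //=.
- by move=> _; rewrite /gpart big_geq // coef1.
- move=> _; rewrite gpartS mulrDr mulr1 mulrCA coefD mul_polyC coefZ coefMX mulr0 addr0.
  exact: IH.
- move=> mN; rewrite gpartS mulrDr mulr1 mulrCA coefD mul_polyC coefZ coefMX /=.
  rewrite ltr_wpDl ?mulr_gt0 ?expR_gt0 ?IH //.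
  by have /polyOverP/(_ m.+1) := gpart_nneg N.
Qed.

Lemma gpart_derivn0_gt0 N m : (m <= N)%N -> 0 < (gpart N)^`(m).[0].
Proof.
move=> mN; rewrite horner_coef0 coef_derivn addn0.
by rewrite pmulrn_lgt0 ?gpart_coef_gt0 // ffactnn fact_gt0.
Qed.

(** The sign is changed so that the [proot m N k] with [k + m < N] are positive
    and increase with [k]; Rolle's theorem makes the set below nonempty. *)
Fixpoint proot (m N k : nat) : R :=
  if m is m'.+1 then
    xget 0 [set x | proot m' N k < x < proot m' N k.+1 /\ (gpart N)^`(m).[- x] = 0]
  else expR k.+1%:R.

Lemma proot_rolle m N k :
  proot m N k < proot m N k.+1 ->
  (gpart N)^`(m).[- proot m N k] = 0 -> (gpart N)^`(m).[- proot m N k.+1] = 0 ->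
  proot m N k < proot m.+1 N k < proot m N k.+1 /\ (gpart N)^`(m.+1).[- proot m.+1 N k] = 0.
Proof.
rewrite -ltrN2 => lt1 r1 r2; have [] // := @xgetPex _ 0
  [set x | proot m N k < x < proot m N k.+1 /\ (gpart N)^`(m.+1).[- x] = 0].
have [|c] := poly_rolle lt1 (p := (gpart N)^`(m)); first by rewrite r1 r2.
rewrite in_itv /= => /andP[c1 c2] hc.
by exists (- c); rewrite opprK; split=> //; lra.
Qed.

Lemma proot_root_lt m N :
  (forall k, (k + m < N)%N -> (gpart N)^`(m).[- proot m N k] = 0) /\
  (forall k, (k.+1 + m < N)%N -> proot m N k < proot m N k.+1).
Proof.
elim: m => [|m [IHr IHl]].
  split=> k; rewrite addn0 => kN; last by rewrite ltr_expR ltr_nat.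
  rewrite derivn0 gpart_horner big_add1 /= big_mkord (bigD1 (Ordinal kN)) //=.
  by rewrite mulrN -expRD addNr expR0 subrr mul0r.
have step k : (k + m.+1 < N)%N ->
    proot m N k < proot m.+1 N k < proot m N k.+1 /\ (gpart N)^`(m.+1).[- proot m.+1 N k] = 0.
  by move=> kN; apply: proot_rolle; [apply: IHl|apply: IHr|apply: IHr]; lia.
split=> k kN; first by case: (step k kN).
have [/andP[_ h1] _] := step k (ltnW kN).
by have [/andP[h2 _] _] := step k.+1 kN; exact: lt_trans h2.
Qed.

Lemma proot_root m N k : (k + m < N)%N -> (gpart N)^`(m).[- proot m N k] = 0.
Proof. by case: (proot_root_lt m N) => h _; exact: h. Qed.

Lemma proot_interlace m N k : (k + m.+1 < N)%N ->
  proot m N k < proot m.+1 N k < proot m N k.+1.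
Proof.
move=> kN; have [IHr IHl] := proot_root_lt m N.
by have [|||//] := @proot_rolle m N k; [apply: IHl|apply: IHr|apply: IHr]; lia.
Qed.

Lemma proot_lt m N j k : (j < k)%N -> (k + m < N)%N -> proot m N j < proot m N k.
Proof.
elim: k => // k IH; rewrite ltnS leq_eqVlt => /orP[/eqP ->|jk] kN.
  by case: (proot_root_lt m N) => _; exact.
apply: lt_trans (IH jk (ltnW kN)) _.
by case: (proot_root_lt m N) => _; exact.
Qed.

Lemma proot_bounds m N k : (k + m < N)%N ->
  expR k.+1%:R <= proot m N k <= expR (k.+1 + m)%:R.
Proof.
elim: m k => [|m IH] k kN; first by rewrite addn0 /= !lexx.
have /andP[h1 h2] := proot_interlace kN.
have kN' : (k.+1 + m < N)%N by rewrite addSnnS.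
have /andP[h3 _] := IH k (ltnW kN').
have /andP[_ h4] := IH k.+1 kN'.
by rewrite (ltW (le_lt_trans h3 h1)) -addSnnS (ltW (lt_le_trans h2 h4)).
Qed.

Lemma proot_gt0 m N k : (k + m < N)%N -> 0 < proot m N k.
Proof. by move=> /proot_bounds/andP[h _]; apply: lt_le_trans h; exact: expR_gt0. Qed.

Lemma gpart_derivn_factor m N : (gpart N)^`(m) =
  (gpart N)^`(m).[0]%:P * \prod_(0 <= k < N - m) (1 + (proot m N k)^-1%:P * 'X).
Proof.
apply: poly_factor_roots.
- exact: size_gpart_derivn.
- by move=> k kN; apply: proot_gt0; lia.
- move=> j k jN kN h; case: (ltngtP j k) => // jk.
    suff : proot m N j < proot m N k by rewrite h ltxx.
    by apply: proot_lt => //; lia.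
  suff : proot m N k < proot m N j by rewrite h ltxx.
  by apply: proot_lt => //; lia.
- by move=> k kN; apply: proot_root; lia.
Qed.
End Product.

(** * Zeros of the derivatives of the infinite product *)

Section ZeroLimits.
Variable R : realType.
Local Notation C := (CC R).
Implicit Types (x y : R) (z : C) (w : nat -> C).
Variable F : set_system nat.
Hypothesis FU : UltraFilter F.
Hypothesis Foo : F `=>` \oo.

Let FP : ProperFilter F := ultra_proper.
#[local] Existing Instance FP.

Lemma near_ultra_gt n : \forall N \near F, (n < N)%N.
Proof. by apply: Foo; exact: nbhs_infty_gt. Qed.

Lemma root_lim_ex m k : exists l : R,
  proot R m N k @[N --> F] --> l /\ expR k.+1%:R <= l <= expR (k.+1 + m)%:R.
Proof.
apply: ultra_bounded_cvg; apply: filterS (near_ultra_gt (k + m)) => N; exact: proot_bounds.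
Qed.

Definition root_lim m k : R := xget 0 [set l : R |
  proot R m N k @[N --> F] --> l /\ expR k.+1%:R <= l <= expR (k.+1 + m)%:R].

Lemma root_limP m k : proot R m N k @[N --> F] --> root_lim m k /\
  expR k.+1%:R <= root_lim m k <= expR (k.+1 + m)%:R.
Proof.
exact: (@xgetPex _ 0 [set l : R | proot R m N k @[N --> F] --> l /\
  expR k.+1%:R <= l <= expR (k.+1 + m)%:R] (root_lim_ex m k)).
Qed.

Lemma root_lim_cvg m k : proot R m N k @[N --> F] --> root_lim m k.
Proof. by case: (root_limP m k). Qed.

Lemma root_lim_gt0 m k : 0 < root_lim m k.
Proof. by case: (root_limP m k) => _ /andP[h _]; apply: lt_le_trans h; exact: expR_gt0. Qed.

Lemma root_lim_factor_cvg m k w z : w @ F --> z ->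
  1 + ofR (proot R m N k)^-1 * w N @[N --> F] --> 1 + ofR (root_lim m k)^-1 * z.
Proof.
move=> wz; apply: cvgD; first exact: cvg_cst.
apply: cvgM; last exact: wz.
apply: (cvg_ofR _ (u := fun N => (proot R m N k)^-1)).
by apply: cvgV; [rewrite gt_eqF // root_lim_gt0|exact: root_lim_cvg].
Qed.

Lemma root_lim_factor_neq0 m k z :
  z != - ofR (root_lim m k) -> 1 + ofR (root_lim m k)^-1 * z != 0.
Proof.
have b0 : ofR (root_lim m k) != 0.
  by rewrite -(rmorph0 (@ofR R)) (inj_eq (@ofR_inj R)) gt_eqF // root_lim_gt0.
apply: contra_neq => h; rewrite -[z]mul1r -(divff b0) -mulrA -fmorphV.
by rewrite (_ : _ * z = - 1) ?mulrN1 //; apply/eqP; rewrite -addr_eq0 addrC h.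
Qed.

(** Deleting one factor keeps the products away from [0]: the far factors are
    controlled by Weierstrass' inequality, the near ones converge. *)
Lemma deleted_prod_lb m k w z : w @ F --> z ->
  (forall j, j != k -> z != - ofR (root_lim m j)) ->
  exists2 d : R, 0 < d & \forall N \near F,
    d <= cabs (\prod_(0 <= j < N - m | j != k) (1 + ofR (proot R m N j)^-1 * w N)).
Proof.
move=> wz hz; pose rho := cabs z + 1.
have rho0 : 0 < rho by rewrite ltr_wpDl ?cabs_ge0.
have [K [kK hK]] : exists K : nat, (k < K)%N /\ 2 * rho <= K%:R.
  have : \forall K \near \oo, (k < K)%N /\ 2 * rho <= K%:R.
    by apply: filterI; [exact: nbhs_infty_gt|exact: nbhs_infty_ger].
  exact: filter_ex.
(* Beyond [K] the terms [rho e^(-j-1)] add up to at most [1 / 2]. *)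
have rhoK : rho * expR (- K%:R) <= 2^-1.
  rewrite expRN ler_pdivrMr ?expR_gt0 //.
  by have := expR_ge1Dx (K%:R : R); lra.
pose H N n := \prod_(0 <= j < n | j != k) (1 + ofR (proot R m N j)^-1 * w N).
pose L n := \prod_(0 <= j < n | j != k) (1 + ofR (root_lim m j)^-1 * z).
have HL n : H N n @[N --> F] --> L n.
  have prodS (f : nat -> C) i : \prod_(0 <= j < i.+1 | j != k) f j =
      (\prod_(0 <= j < i | j != k) f j) * (if i != k then f i else 1).
    by rewrite big_mkcond big_nat_recr //= -big_mkcond.
  elim: n => [|n IH].
    have -> : H^~ 0%N = cst 1 by apply/funext => N; rewrite /H big_geq.
    have -> : L 0%N = 1 by rewrite /L big_geq.
    exact: cvg_cst.
  have -> : H^~ n.+1 = fun N =>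
      H N n * (if n != k then 1 + ofR (proot R m N n)^-1 * w N else 1).
    by apply/funext => N; rewrite /H prodS.
  have -> : L n.+1 = L n * (if n != k then 1 + ofR (root_lim m n)^-1 * z else 1).
    by rewrite /L prodS.
  apply: cvgM; first exact: IH.
  by case: ifP => _; [apply: root_lim_factor_cvg|apply: cvg_cst].
have L0 n : 0 < cabs (L n).
  rewrite cabs_gt0 /L prodf_seq_neq0; apply/allP => j _; apply/implyP => jk.
  exact/root_lim_factor_neq0/hz.
exists (cabs (L K) / 2 * 2^-1); first by rewrite !mulr_gt0 ?L0 // invr_gt0.
have near1 : \forall N \near F, cabs (L K) / 2 <= cabs (H N K).
  apply: (cvgr_ge _ (cvg_cabs _ (HL K))).
  by rewrite ltr_pdivrMr // ltr_pMr ?L0 // ltr1n.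
have near2 : \forall N \near F, cabs (w N) <= rho.
  by apply: (cvgr_le _ (cvg_cabs _ wz)); rewrite /rho ltrDl.
near=> N.
have N1 : cabs (L K) / 2 <= cabs (H N K) by near: N.
have N2 : cabs (w N) <= rho by near: N.
have N3 : (K + m < N)%N by near: N; exact: near_ultra_gt.
rewrite (@big_cat_nat _ _ _ K) //=; last by lia.
rewrite cabsM ler_pM ?divr_ge0 ?cabs_ge0 //.
have -> : \prod_(K <= j < N - m | j != k) (1 + ofR (proot R m N j)^-1 * w N) =
    \prod_(K <= j < N - m) (1 + ofR (proot R m N j)^-1 * w N).
  rewrite big_nat_cond [RHS]big_nat_cond; apply: eq_bigl => j.
  by case: eqP => [->|_]; lia.
rewrite cabs_prod.
apply: (@le_trans _ _ (\prod_(K <= j < N - m) (1 - rho * expR (- j.+1%:R)))).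
  have hx j : (K <= j < N - m)%N && true -> 0 <= rho * expR (- j.+1%:R) <= 1.
    move=> /andP[/andP[Kj _] _]; rewrite mulr_ge0 ?expR_ge0 ?(ltW rho0) //=.
    apply: (@le_trans _ _ (rho * expR (- K%:R))); last by lra.
    by rewrite ler_pM2l // ler_expR lerN2 ler_nat; lia.
  have := prod_onem_ge (index_iota K (N - m)) hx.
  rewrite -!big_nat_cond => h; apply: (le_trans _ h).
  rewrite -mulr_sumr; have := sum_expRN_le R K (N - m).
  by move: rhoK; nra.
rewrite big_nat_cond [leRHS]big_nat_cond; apply: ler_prod => j /andP[/andP[Kj jN] _].
apply/andP; split.
  rewrite subr_ge0; apply: (@le_trans _ _ (rho * expR (- K%:R))); last by lra.
  by rewrite ler_pM2l // ler_expR lerN2 ler_nat; lia.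
have := cabsB_le 1 (- (ofR (proot R m N j)^-1 * w N)); rewrite opprK cabs1 cabsN => h.
apply: (le_trans _ h); rewrite lerD2l lerN2 cabsM cabs_ofR mulrC.
have /(proot_bounds R)/andP[hb _] : (j + m < N)%N by lia.
have zj0 : 0 < proot R m N j by apply: lt_le_trans hb; exact: expR_gt0.
have iz0 : 0 <= (proot R m N j)^-1 by rewrite invr_ge0 ltW.
rewrite (ger0_norm iz0); apply: (ler_pM (cabs_ge0 _) iz0 N2).
by rewrite expRN lef_pV2 // posrE expR_gt0.
Unshelve. all: by end_near. Qed.

Lemma pC_gpart_factor m N z : (pC (gpart R N)^`(m)).[z] =
  ofR (gpart R N)^`(m).[0] * \prod_(0 <= k < N - m) (1 + ofR (proot R m N k)^-1 * z).
Proof.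
rewrite [in LHS]gpart_derivn_factor rmorphM rmorph_prod hornerM horner_prod /=.
rewrite map_polyC hornerC.
congr (_ * _); apply: eq_bigr => j _.
by rewrite rmorphD rmorphM rmorph1 /= map_polyC map_polyX !hornerE.
Qed.

Lemma gpart_derivn0_lb m N : (m <= N)%N -> (gpart R m)^`(m).[0] <= (gpart R N)^`(m).[0].
Proof. by move=> mN; apply: P_derivn_mono => //; exact: gpart_mono. Qed.

Lemma gder_root_lim m k : gder m (- ofR (root_lim m k)) = 0.
Proof.
have wz : - ofR (proot R m N k) @[N --> F] --> - ofR (root_lim m k).
  by apply: cvgN; apply: cvg_ofR; exact: root_lim_cvg.
have h1 := polylim_cvg_moving (@gpart_nneg R) (@gpart_mono R)
  (@gpart_bnd R) (m := m) FP Foo wz.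
have h2 : (pC (gpart R N)^`(m)).[- ofR (proot R m N k)] @[N --> F] --> (0 : C).
  apply: cvg_near_cst.
  apply: filterS (near_ultra_gt (k + m)) => N kN.
  by rewrite -rmorphN horner_map proot_root ?rmorph0.
exact: cvg_unique h1 h2.
Qed.

Lemma bigD1_nat (n k : nat) (f : nat -> C) : (k < n)%N ->
  \prod_(0 <= j < n) f j = f k * \prod_(0 <= j < n | j != k) f j.
Proof. by move=> kn; rewrite (bigD1_seq k) ?iota_uniq // mem_index_iota. Qed.

(** Elsewhere the partial products stay away from [0]. *)
Lemma gder_eq0_root_lim m z : gder m z = 0 -> exists k, z = - ofR (root_lim m k).
Proof.
move=> Gz; apply: contrapT => /forallNP hz.
have {}hz k : z != - ofR (root_lim m k) by apply/eqP; exact: hz.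
have wz : z @[N --> F] --> z by exact: cvg_cst.
have [d d0 hd] := deleted_prod_lb (k := 0%N) wz (fun j _ => hz j).
have /(cvg_cabs _) h1 := root_lim_factor_cvg (m := m) (k := 0%N) wz.
have l0 : 0 < cabs (1 + ofR (root_lim m 0)^-1 * z) by rewrite cabs_gt0 root_lim_factor_neq0.
set l := cabs _ in h1 l0.
have near1 : \forall N \near F, l / 2 <= cabs (1 + ofR (proot R m N 0)^-1 * z).
  by apply: (cvgr_ge _ h1); rewrite ltr_pdivrMr // ltr_pMr // ltr1n.
have /(cvg_cabs _) h2 := polylim_cvg_moving (@gpart_nneg R) (@gpart_mono R)
  (@gpart_bnd R) (m := m) FP Foo wz.
have c0 := gpart_derivn0_gt0 R (leqnn m).
suff : (gpart R m)^`(m).[0] * (l / 2 * d) <= cabs (gder m z).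
  by rewrite Gz cabs0 leNgt !mulr_gt0.
apply: cvgr_to_ge h2 _; near=> N.
have N0 : (0 + m < N)%N by near: N; exact: near_ultra_gt.
rewrite pC_gpart_factor (bigD1_nat _ (k := 0%N)); last by lia.
have l2 : 0 <= l / 2 by rewrite divr_ge0 // ltW.
rewrite !cabsM cabs_ofR; apply: (ler_pM (ltW c0) (mulr_ge0 l2 (ltW d0))).
  by apply: le_trans (ler_norm _); apply: gpart_derivn0_lb; lia.
by apply: (ler_pM l2 (ltW d0)); near: N.
Unshelve. all: by end_near. Qed.

(** Up to bounded factors, the derivative of a partial product at one of its roots
    is the product with the corresponding factor deleted. *)
Lemma gder_simple m k : (forall j, j != k -> root_lim m j != root_lim m k) ->
  gder m.+1 (- ofR (root_lim m k)) != 0.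
Proof.
move=> hk.
have wz : - ofR (proot R m N k) @[N --> F] --> - ofR (root_lim m k).
  by apply: cvgN; apply: cvg_ofR; exact: root_lim_cvg.
have [|d d0 hd] := deleted_prod_lb (m := m) (k := k) wz.
  by move=> j /hk; rewrite eqr_opp (inj_eq (@ofR_inj R)) eq_sym.
have /(cvg_cabs _) h2 := polylim_cvg_moving (@gpart_nneg R) (@gpart_mono R)
  (@gpart_bnd R) (m := m.+1) FP Foo wz.
have c0 := gpart_derivn0_gt0 R (leqnn m).
have e0 := expR_gt0 (k.+1 + m)%:R : 0 < _ :> R.
suff : (gpart R m)^`(m).[0] * ((expR (k.+1 + m)%:R)^-1 * d) <=
  cabs (gder m.+1 (- ofR (root_lim m k))).
  by move=> h; rewrite -cabs_gt0; apply: lt_le_trans h; rewrite !mulr_gt0 // invr_gt0.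
apply: cvgr_to_ge h2 _; near=> N.
have N0 : (k + m < N)%N by near: N; exact: near_ultra_gt.
have N1 : d <= cabs (\prod_(0 <= j < N - m | j != k)
    (1 + ofR (proot R m N j)^-1 * - ofR (proot R m N k))) by near: N.
have zk := proot_gt0 R N0.
pose Q := \prod_(0 <= j < N - m | j != k) (1 + (proot R m N j)^-1%:P * 'X : {poly R}).
have -> : (gpart R N)^`(m.+1) = ((gpart R N)^`(m).[0]%:P *
    ((1 + (proot R m N k)^-1%:P * 'X) * Q))^`().
  rewrite derivnS [in LHS]gpart_derivn_factor (bigD1_seq k) ?iota_uniq //.
  by rewrite mem_index_iota; lia.
rewrite -rmorphN horner_map /= cabs_ofR.
rewrite derivM derivC mul0r add0r derivM derivD derivM derivX !derivC.
rewrite !hornerE mulrN mulVf ?gt_eqF // subrr mul0r addr0.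
have e1 : 0 <= (expR (k.+1 + m)%:R)^-1 :> R by rewrite invr_ge0 ltW.
rewrite -[leLHS]mulrA normrM; apply: (ler_pM (ltW c0) (mulr_ge0 e1 (ltW d0))).
  by apply: le_trans (ler_norm _); apply: gpart_derivn0_lb; lia.
rewrite normrM; apply: (ler_pM e1 (ltW d0)).
  rewrite ger0_norm; last by rewrite invr_ge0 ltW.
  rewrite lef_pV2 ?posrE //.
  by have /andP[] := proot_bounds R N0.
apply: le_trans N1 _; rewrite -cabs_ofR horner_prod rmorph_prod.
rewrite le_eqVlt; apply/orP; left; apply/eqP; congr cabs.
by apply: eq_bigr => j _; rewrite !hornerE rmorphD rmorphM rmorphN rmorph1.
Unshelve. all: by end_near. Qed.

Lemma root_lim_interlace m k : root_lim m k <= root_lim m.+1 k <= root_lim m k.+1.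
Proof.
have h : \forall N \near F, proot R m N k <= proot R m.+1 N k <= proot R m N k.+1.
  apply: filterS (near_ultra_gt (k + m.+1)) => N /(proot_interlace R)/andP[h1 h2].
  by rewrite !ltW.
apply/andP; split.
  apply: (ler_cvg_to (@root_lim_cvg m k) (@root_lim_cvg m.+1 k)).
  by apply: filterS h => N /andP[].
apply: (ler_cvg_to (@root_lim_cvg m.+1 k) (@root_lim_cvg m k.+1)).
by apply: filterS h => N /andP[].
Qed.

(** Interlacing stays strict in the limit: the zeros of the [m]-th derivative are
    simple by induction, so the next derivative does not vanish at any of them. *)
Lemma root_lim_lt m j k : (j < k)%N -> root_lim m j < root_lim m k.
Proof.
elim: m j k => [|m IH] j k jk.
  have zE i : root_lim 0 i = expR i.+1%:R.
    have h : proot R 0 N i @[N --> F] --> expR i.+1%:R by exact: cvg_cst.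
    exact: cvg_unique (@root_lim_cvg 0 i) h.
  by rewrite !zE ltr_expR ltr_nat.
have hne i l : root_lim m.+1 i != root_lim m l.
  have : gder m.+1 (- ofR (root_lim m l)) != 0.
    apply: gder_simple => a al; case: (ltngtP a l) al => // h _.
      by rewrite lt_eqF // IH.
    by rewrite gt_eqF // IH.
  by apply: contra_neq => <-; exact: gder_root_lim.
have h1 i : root_lim m i < root_lim m.+1 i.
  by rewrite lt_neqAle eq_sym hne; have /andP[] := root_lim_interlace m i.
have h2 i : root_lim m.+1 i < root_lim m i.+1.
  by rewrite lt_neqAle hne; have /andP[] := root_lim_interlace m i.
apply: lt_le_trans (h2 j) _; apply: le_trans (ltW (h1 k)).
move: jk; rewrite leq_eqVlt => /orP[/eqP -> //|jk].
by apply: ltW; exact: IH.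
Qed.

End ZeroLimits.

(** Laguerre's theorem for the product: differentiation keeps the zeros negative
    and simple, and moves the [k]-th one at most to the next, which determines
    the counting function up to a bounded error. *)
Theorem zeros_gder (R : realType) (m : nat) : exists b : nat -> R,
  [/\ {homo b : j k / (j < k)%N >-> j < k},
      forall k, expR k.+1%:R <= b k <= expR (k.+1 + m)%:R,
      forall z : CC R, gder m z = 0 <-> exists k, z = - ofR (b k)
    & forall k, gder m.+1 (- ofR (b k)) != 0].
Proof.
have [F [FU Foo]] := @ultraFilterLemma nat \oo _.
exists (@root_lim R F m); split.
- by move=> j k; exact: (root_lim_lt R FU Foo).
- by move=> k; case: (@root_limP R F FU Foo m k).
- move=> z; split=> [|[k ->]]; first exact: (gder_eq0_root_lim FU Foo).
  exact: (gder_root_lim R FU Foo).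
- move=> k; apply: (gder_simple FU Foo) => j; case: (ltngtP j k) => // h _.
    by rewrite lt_eqF // (root_lim_lt R FU Foo).
  by rewrite gt_eqF // (root_lim_lt R FU Foo).
Qed.

(** * Logarithmic integrals of counting functions *)

Section LogIntegral.
Variable R : realType.
Local Notation mu := (@lebesgue_measure R).
Implicit Types (r t c : R).

Lemma log_integrand_continuous c r : 1 < r ->
  {within `[1, r], continuous (fun t => (ln t - c) / t)}.
Proof.
move=> r1; apply: continuous_in_subspaceT => t; rewrite inE /= in_itv /= => /andP[t1 _].
have t0 : 0 < t by apply: lt_le_trans t1.
apply: cvgM; first by apply: cvgB; [exact: continuous_ln|exact: cvg_cst].
by apply: cvgV; [rewrite gt_eqF|exact: cvg_id].
Qed.

Lemma log_integral c r : 1 < r ->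
  \int[mu]_(t in `[1, r]) ((ln t - c) / t) = ln r ^+ 2 / 2 - c * ln r.
Proof.
move=> r1; pose H t : R := 2^-1 * (ln t * ln t) - c * ln t.
have dH t : 0 < t -> is_derive t 1 H ((ln t - c) / t).
  move=> t0; have dl := is_derive1_ln t0.
  have h := is_deriveB (is_deriveZ 2^-1 (is_deriveM dl dl)) (is_deriveZ c dl).
  apply: (is_derive_eq h); rewrite /GRing.scale /=.
  by field; rewrite gt_eqF.
rewrite /Rintegral (@continuous_FTC2 _ _ H _ _ r1 (log_integrand_continuous (c := c) r1)).
- by rewrite -EFinB /= /H ln1 !(mul0r, mulr0, subr0) expr2 mulrC.
- have cH t : 0 < t -> H @ t --> H t.
    move=> /dH[h _]; apply: differentiable_continuous; exact/derivable1_diffP.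
  split.
  + move=> t; rewrite in_itv /= => /andP[t1 _].
    by have [] := dH t (lt_trans ltr01 t1).
  + by apply: cvg_at_right_filter; apply: cH.
  + by apply: cvg_at_left_filter; apply: cH; apply: lt_trans r1.
- move=> t; rewrite in_itv /= => /andP[t1 _].
  by rewrite derive1E; have [_ ->] := dH t (lt_trans ltr01 t1).
Qed.

(** The integrand vanishes up to [1] and is compared with that of [log_integral]
    on the rest; monotonicity provides the measurability. *)
Lemma log_count_integral (nu : R -> R) c r : 1 < r ->
  (forall s t, s <= t -> nu s <= nu t) ->
  (forall t, t < 1 -> nu t = 0) ->
  (forall t, 1 <= t -> ln t - c <= nu t <= ln t) ->
  ln r ^+ 2 / 2 - c * ln r <= \int[mu]_(t in `[0, r]) (nu t / t) <= ln r ^+ 2 / 2.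
Proof.
move=> r1 nu_mono nu0 nu_ln.
(* [nu] vanishes near the singularity of [1 / t]. *)
have -> : \int[mu]_(t in `[0, r]) (nu t / t) = \int[mu]_(t in `[1, r]) (nu t / t).
  rewrite Rintegral_mkcond [RHS]Rintegral_mkcond; congr (Rintegral _ _ _).
  apply/funext => t; rewrite !patchE !mem_setE !in_itv /=.
  have [t1|t1] := leP 1 t; first by rewrite (le_trans ler01 t1).
  by rewrite nu0 // mul0r; case: ifP.
have mI : measurable (`[1, r]%classic : set R) by [].
have iln d : mu.-integrable `[1, r] (EFin \o (fun t => (ln t - d) / t)).
  apply: continuous_compact_integrable; first exact: segment_compact.
  exact: log_integrand_continuous.
have inu : mu.-integrable `[1, r] (EFin \o (fun t => nu t / t)).
  apply: measurable_bounded_integrable => //.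
  - by rewrite /= lebesgue_measure_itv /= lte_fin r1 -EFinB ltry.
  - apply: measurable_funM; first by apply: nondecreasing_measurable.
    apply: subspace_continuous_measurable_fun => //.
    apply: continuous_in_subspaceT => t; rewrite inE /= in_itv /= => /andP[t1 _].
    by apply: cvgV; [rewrite gt_eqF // (lt_le_trans ltr01 t1)|exact: cvg_id].
  - exists (ln r); split; first exact: num_real.
    move=> M hM t; rewrite /= in_itv /= => /andP[t1 tr].
    have t0 : 0 < t by apply: lt_le_trans t1.
    have l0 : 0 <= nu t by rewrite -(nu0 0) // nu_mono // ltW.
    have /andP[_ h2] := nu_ln _ t1.
    rewrite ger0_norm; last by rewrite divr_ge0 // ltW.
    rewrite ler_pdivrMr //; apply: le_trans h2 _.
    have : ln t <= ln r by rewrite ler_ln ?posrE // (lt_le_trans t0 tr).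
    have := ln_ge0 t1; nra.
apply/andP; split.
  rewrite -log_integral //; apply: le_Rintegral => // t.
  rewrite /= in_itv /= => /andP[t1 _]; have /andP[h _] := nu_ln _ t1.
  by rewrite ler_wpM2r // invr_ge0 (le_trans ler01 t1).
have -> : ln r ^+ 2 / 2 = ln r ^+ 2 / 2 - 0 * ln r by rewrite mul0r subr0.
rewrite -log_integral //; apply: le_Rintegral => // t.
rewrite /= in_itv /= => /andP[t1 _]; have /andP[_ h] := nu_ln _ t1.
by rewrite subr0 ler_wpM2r // invr_ge0 (le_trans ler01 t1).
Qed.
End LogIntegral.

(** * The Wronskian and its zeros *)

Section Wronskian.
Variable R : realType.
Local Notation C := (CC R).
Implicit Types (r t : R) (z : C).

Lemma polylim_cst (p : {poly R}) m z : polylim (fun _ => p) m z = (pC p^`(m)).[z].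
Proof. exact: lim_cst. Qed.

(** A constant sequence of polynomials is an increasing one. *)
Lemma derive1n_nneg_poly (p : {poly R}) k : p \is a nneg ->
  derive1n k (fun z : C => (pC p).[z]) = fun z => (pC p^`(k)).[z].
Proof.
move=> hp; have h0 N M : (N <= M)%N -> p - p \is a nneg by rewrite subrr polyOver0.
have hb x : 0 <= x -> exists B, forall N : nat, p.[x] <= B by exists p.[x].
have e m : polylim (fun _ => p) m = (fun z => (pC p^`(m)).[z]).
  by apply/funext => z; exact: polylim_cst.
by rewrite -[RHS]e -(polylim_derive1n (fun _ => hp) h0 hb 0) e.
Qed.

Lemma derive1n_exp j k z :
  derive1n k (fun z : C => z ^+ j) z = (pC (('X^j : {poly R})^`(k))).[z].
Proof.
have -> : (fun z : C => z ^+ j) = fun z => (pC 'X^j).[z].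
  by apply/funext => w; rewrite map_polyXn hornerXn.
by rewrite derive1n_nneg_poly // polyOverXn.
Qed.

Lemma entire_exp j : entire (fun z : C => z ^+ j).
Proof. by move=> z; exact: exprn_derivable. Qed.

Lemma gprod_derive1n k : derive1n k (@gprod R) = gder k.
Proof.
rewrite gprodE /gder (polylim_derive1n (@gpart_nneg R) (@gpart_mono R) (@gpart_bnd R)).
by rewrite add0n.
Qed.

Lemma gprod_entire : entire (@gprod R).
Proof.
move=> z; rewrite gprodE.
by have [] := polylim_is_derive (@gpart_nneg R) (@gpart_mono R) (@gpart_bnd R) 0 z.
Qed.

(** The matrix is triangular because ['X^j] is killed by [j + 1] derivatives. *)
Lemma wronskianE n : exists2 c : C, c != 0 &
  wronskian (@gcurve R n) = fun z => c * gder n z.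
Proof.
exists (\prod_(j < n) (j`!%:R : C)).
  by apply/prodf_neq0 => j _; rewrite pnatr_eq0 -lt0n fact_gt0.
apply/funext => z; rewrite /wronskian -det_tr det_trig.
  rewrite big_ord_recr /=; congr (_ * _).
    apply: eq_bigr => j _; rewrite !mxE /gcurve /= ltn_ord derive1n_exp.
    by rewrite derivnXn subnn expr0 ffactnn rmorphMn rmorph1 hornerMn hornerC.
  by rewrite !mxE /gcurve /= ltnn gprod_derive1n.
apply/is_trig_mxP => i j ij; rewrite !mxE /gcurve (leq_trans ij) -1?ltnS ?ltn_ord //.
by rewrite derive1n_exp derivnXn ffact_small // mulr0n rmorph0 horner0.
Qed.

Section Counting.
Variables (n : nat) (b : nat -> R).
Hypothesis b_mono : {homo b : j k / (j < k)%N >-> j < k}.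
Hypothesis b_bounds : forall k, expR k.+1%:R <= b k <= expR (k.+1 + n)%:R.
Hypothesis b_zeros : forall z : C, gder n z = 0 <-> exists k, z = - ofR (b k).
Hypothesis b_simple : forall k, gder n.+1 (- ofR (b k)) != 0.

Let W := wronskian (@gcurve R n).

Lemma zero_seq_gt0 k : 0 < b k.
Proof. by have /andP[h _] := b_bounds k; apply: lt_le_trans h; exact: expR_gt0. Qed.

Lemma order_wronskian k : order_at W (- ofR (b k)) = 1%N.
Proof.
have [c c0 WE] := wronskianE n.
have W0 : W (- ofR (b k)) = 0.
  by rewrite /W WE (b_zeros _).2 ?mulr0 //; exists k.
have W1 : derive1n 1 W (- ofR (b k)) != 0.
  have [h1 h2] := polylim_is_derive (@gpart_nneg R) (@gpart_mono R) (@gpart_bnd R) n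
    (- ofR (b k)).
  rewrite derive1n1 derive1E /W WE.
  have -> : (fun z => c * gder n z) = c \*: polylim (gpart R) n by [].
  by rewrite deriveZ // h2 mulf_neq0 // b_simple.
apply: xget_unique; first by split=> // -[|i] // _; rewrite derive1n0.
move=> [|[|k']] [h1 h2] //; first by rewrite derive1n0 W0 eqxx in h2.
by have := h1 1%N isT => /eqP; rewrite (negPf W1).
Qed.

(** All zeros are simple, so the multiplicities in the count are [1]. *)
Lemma zero_count_wronskian K t : (forall k, (k < K)%N = (b k <= t)) ->
  zero_count W t = K.
Proof.
move=> hK; have [c c0 WE] := wronskianE n.
have -> : zero_count W t =
    \sum_(z \in (fun k => - ofR (b k)) @` `I_K) order_at W z.
  rewrite /zero_count; apply: eq_fsbigl; apply/seteqP; split=> z /=.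
    move=> [zt]; rewrite /W WE => /eqP; rewrite mulf_eq0 (negPf c0) /= => /eqP.
    move=> /(b_zeros _).1[k zk]; exists k => //=.
    by rewrite hK; move: zt; rewrite zk cabsN cabs_ofR gtr0_norm // zero_seq_gt0.
  move=> [k /= kK <-]; split.
    by rewrite cabsN cabs_ofR gtr0_norm ?zero_seq_gt0 // -hK.
  by rewrite /W WE (b_zeros _).2 ?mulr0 //; exists k.
rewrite fsbig_image => [|j k _ _ /oppr_inj/(@ofR_inj R)]; last first.
  by case: (ltngtP j k) => // /b_mono h bjk; rewrite bjk ltxx in h.
under eq_fsbigr do rewrite order_wronskian.
by rewrite -(fsbig_ord _ _ (fun=> 1%N)) sum1_card card_ord.
Qed.

Lemma zero_count_ex t : exists2 K : nat, (forall k, (k < K)%N = (b k <= t)) &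
  zero_count W t = K.
Proof.
have [|K hK hmin] := @ex_minnP (fun k => t < b k).
  have [k hk] : exists k : nat, t <= k%:R.
    by apply: (@filter_ex _ \oo); exact: nbhs_infty_ger.
  exists k; apply: le_lt_trans hk _; have /andP[h _] := b_bounds k.
  apply: lt_le_trans h; apply: lt_le_trans (expR_ge1Dx _).
  by rewrite -natr1; lra.
have h k : (k < K)%N = (b k <= t).
  apply/idP/idP => [kK|bt].
    by rewrite leNgt; apply/negP => /hmin; rewrite leqNgt kK.
  rewrite ltnNge; apply/negP; rewrite leq_eqVlt => /orP[/eqP Kk|/b_mono Kk].
    by move: hK; rewrite Kk ltNge bt.
  by have := lt_trans hK Kk; rewrite ltNge bt.
by exists K => //; exact: zero_count_wronskian.
Qed.

Lemma N1_bounds_aux r : 1 < r ->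
  ln r ^+ 2 / 2 - n.+1%:R * ln r <= N1 (@gcurve R n) r <= ln r ^+ 2 / 2.
Proof.
move=> r1.
have z1 t : t < 1 -> zero_count W t = 0%N.
  move=> t1; apply: zero_count_wronskian => k; rewrite ltn0; apply/esym/negbTE.
  rewrite -ltNge; have /andP[h _] := b_bounds k; apply: lt_le_trans h.
  by apply: lt_trans t1 _; rewrite expR_gt1.
rewrite /N1 -/W (z1 0) // mul0r addr0.
under eq_Rintegral do rewrite subr0.
apply: log_count_integral => //.
- move=> s t st; rewrite ler_nat.
  have [K hK ->] := zero_count_ex s; have [K' hK' ->] := zero_count_ex t.
  rewrite leqNgt; apply/negP => h; have := hK K'; rewrite h.
  by move/esym/le_trans => /(_ _ st); rewrite -hK' ltnn.
- by move=> t /z1 ->.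
- move=> t t1; have [K hK ->] := zero_count_ex t; apply/andP; split.
    have : t < b K by rewrite ltNge -hK ltnn.
    have /andP[_ h] := b_bounds K; move=> /lt_le_trans/(_ h).
    rewrite lerBlDr => /ltW.
    rewrite -[X in X <= expR _]lnK ?posrE ?(lt_le_trans ltr01 t1) // ler_expR.
    by rewrite -natrD addnS addSn.
  case: K hK => [|K] hK; first exact: ln_ge0.
  have : b K <= t by rewrite -hK.
  have /andP[h _] := b_bounds K; move=> /(le_trans h).
  rewrite -[X in _ <= X -> _]lnK ?posrE ?(lt_le_trans ltr01 t1) //.
  by rewrite ler_expR.
Qed.
End Counting.

(** The number [K] of zeros in the disc of radius [t >= 1] satisfies [e^K <= t]
    and [t < e^(K + 1 + n)], that is, [ln t - (n + 1) <= K <= ln t]. *)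
Theorem N1_bounds n r : 1 < r ->
  ln r ^+ 2 / 2 - n.+1%:R * ln r <= N1 (@gcurve R n) r <= ln r ^+ 2 / 2.
Proof.
have [b [h1 h2 h3 h4]] := zeros_gder R n.
exact: N1_bounds_aux h1 h2 h3 h4 r.
Qed.
End Wronskian.

(** * Growth of the product *)

Section ProductGrowth.
Variable R : realType.
Local Notation C := (CC R).
Implicit Types (L r x : R) (z : C).

Lemma sum_linear L J : \sum_(1 <= j < J.+1) (L - j%:R) = J%:R * L - J%:R * J.+1%:R / 2.
Proof.
elim: J => [|J IH]; first by rewrite big_geq // !mul0r subr0.
by rewrite big_nat_recr //= IH -!natr1; field.
Qed.

(** Factors with [j <= L] are at most [2 r e^(-j) <= e^(1 + L - j)]; the others
    contribute a bounded factor. *)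
Lemma gpart_growth_le N L : 0 <= L ->
  (gpart R N).[expR L] <= expR (L ^+ 2 / 2 + L + expR 1).
Proof.
move=> L0; have /andP[JL LJ] := truncn_itv L0; set J := Num.truncn L in JL LJ.
have r0 := expR_ge0 L.
apply: (@le_trans _ _ (gpart R (N + J)).[expR L]).
  by have := P_derivn_mono (@gpart_mono R) 0 r0 (leq_addr J N); rewrite !derivn0.
rewrite gpart_horner (@big_cat_nat _ _ _ J.+1) //=; last by rewrite ltnS leq_addl.
apply: (@le_trans _ _ (expR (\sum_(1 <= j < J.+1) (1 + L - j%:R)) * expR (expR 1))).
  apply: ler_pM.
  - by apply: prodr_ge0 => j _; rewrite addr_ge0 // mulr_ge0 // expR_ge0.
  - by apply: prodr_ge0 => j _; rewrite addr_ge0 // mulr_ge0 // expR_ge0.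
  - rewrite expR_sum big_nat_cond [leRHS]big_nat_cond.
    apply: ler_prod => j /andP[/andP[j1 jJ] _].
    rewrite addr_ge0 ?mulr_ge0 ?expR_ge0 //= -expRD.
    have h : 1 <= expR (- j%:R + L).
      rewrite -[leLHS]expR0 ler_expR addrC subr_ge0; apply: (le_trans _ JL).
      by rewrite ler_nat -ltnS.
    have -> : 1 + L - j%:R = 1 + (- j%:R + L) by ring.
    by rewrite [leRHS]expRD; have := ge2_expR1 R; nra.
  - apply: (@le_trans _ _ (\prod_(J.+1 <= j < (N + J).+1) expR (expR (- j%:R) * expR L))).
      apply: ler_prod => j _; rewrite expR_ge1Dx andbT.
      by rewrite addr_ge0 // mulr_ge0 // expR_ge0.
    rewrite -expR_sum ler_expR -mulr_suml big_add1 /=.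
    apply: le_trans (ler_wpM2r r0 (sum_expRN_le R J (N + J))) _.
    by rewrite -expRD ler_expR; move: LJ; rewrite -natr1; lra.
rewrite -expRD ler_expR lerD2r.
rewrite sum_linear.
have := sqr_ge0 (L - J%:R); rewrite -natr1; have : 0 <= J%:R :> R by [].
nra.
Qed.

(** About [L] factors make up the main term, so that a loss of [e^(- k)] on each
    of them costs a multiple of [L]. *)
Lemma pC_gpart_growth_ge N L k z : 0 <= L -> 0 <= k -> cabs z = expR L ->
  (L + 3 <= N%:R) ->
  (forall a : R, 0 <= a -> expR (- k) * Num.max 1 (a * expR L) <= cabs (1 + ofR a * z)) ->
  expR (L ^+ 2 / 2 - (L + 2) * (k + 1)) <= cabs (pC (gpart R N)).[z].
Proof.
move=> L0 k0 zL LN hk; have /andP[JL LJ] := truncn_itv L0; set J := Num.truncn L in JL LJ.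
have r0 := expR_ge0 L.
have JN : (J + 3 <= N)%N by rewrite -(ler_nat R) natrD; apply: (le_trans _ LN); rewrite lerD2r.
rewrite pC_gpart_horner cabs_prod (@big_cat_nat _ _ _ J.+1) //=; last by lia.
rewrite (@big_cat_nat _ _ _ J.+3 J.+1) //=; [|lia|lia].
(* The two factors [j = J + 1, J + 2] separate the large factors from those with
   [r e^(-j) <= e^(-1) <= 1 / 2], to which Weierstrass' inequality applies. *)
have mid : expR (- k) * expR (- k) <=
    \prod_(J.+1 <= j < J.+3) cabs (1 + ofR (expR (- j%:R)) * z).
  rewrite big_nat_recr // big_nat1 /=.
  have h j : expR (- k) <= cabs (1 + ofR (expR (- j%:R)) * z).
    apply: le_trans (hk _ (expR_ge0 _)); rewrite ler_peMr ?expR_ge0 //.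
    by rewrite le_max lexx.
  by apply: ler_pM; rewrite ?expR_ge0.
have head : expR (\sum_(1 <= j < J.+1) (L - k - j%:R)) <=
    \prod_(1 <= j < J.+1) cabs (1 + ofR (expR (- j%:R)) * z).
  rewrite expR_sum; apply: ler_prod => j _; rewrite expR_ge0 /=.
  apply: le_trans (hk _ (expR_ge0 _)); rewrite -expRD.
  have -> : L - k - j%:R = - k + (- j%:R + L) by ring.
  by rewrite [leLHS]expRD ler_pM2l ?expR_gt0 // le_max lexx orbT.
have tail : expR (- 1) <= \prod_(J.+3 <= j < N.+1) cabs (1 + ofR (expR (- j%:R)) * z).
  have e1 : expR (- 1) <= 2^-1 :> R.
    by rewrite expRN lef_pV2 ?posrE ?expR_gt0 // ge2_expR1.
  have hJ j : (J.+3 <= j)%N -> expR (- j%:R) * expR L <= expR (- 1).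
    rewrite -(ler_nat R) -expRD ler_expR => h; move: LJ h; rewrite -!natr1; lra.
  apply: (@le_trans _ _ (\prod_(J.+3 <= j < N.+1) (1 - expR (- j%:R) * expR L))).
    have hx j : (J.+3 <= j < N.+1)%N && true -> 0 <= expR (- j%:R) * expR L <= 1.
      move=> /andP[/andP[/hJ h _] _]; rewrite mulr_ge0 ?expR_ge0 //=.
      by apply: le_trans h _; lra.
    have := prod_onem_ge (index_iota J.+3 N.+1) hx.
    rewrite -!big_nat_cond => h; apply: (le_trans _ h).
    rewrite -mulr_suml big_add1 /=.
    have h2 := ler_wpM2r r0 (sum_expRN_le R J.+2 N).
    have : expR (- J.+2%:R) * expR L <= expR (- 1).
      by rewrite -expRD ler_expR; move: LJ; rewrite -!natr1; lra.
    lra.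
  rewrite big_nat_cond [leRHS]big_nat_cond; apply: ler_prod => j /andP[/andP[/hJ h _] _].
  apply/andP; split; first by lra.
  have := cabsB_le 1 (- (ofR (expR (- j%:R)) * z)).
  by rewrite opprK cabs1 cabsN cabsM cabs_ofR ger0_norm ?expR_ge0 // zL.
have sumE : \sum_(1 <= j < J.+1) (L - k - j%:R) = J%:R * (L - k) - J%:R * J.+1%:R / 2.
  by rewrite -sum_linear.
apply: (@le_trans _ _ (expR (\sum_(1 <= j < J.+1) (L - k - j%:R)) *
    (expR (- k) * expR (- k) * expR (- 1)))).
  rewrite -!expRD ler_expR sumE.
  move: JL LJ; rewrite -[J.+1%:R]natr1; set j := J%:R => JL LJ.
  have j0 : 0 <= j by rewrite /j.
  have : (L - j) ^+ 2 <= 1 by rewrite expr_le1 //; lra.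
  have : 0 <= k * (L - j) by rewrite mulr_ge0 // subr_ge0.
  lra.
by apply: ler_pM; rewrite ?mulr_ge0 ?expR_ge0 //; apply: ler_pM; rewrite ?mulr_ge0 ?expR_ge0.
Qed.

Lemma g_growth_le z L : 0 <= L -> cabs z = expR L ->
  cabs (gder 0 z) <= expR (L ^+ 2 / 2 + L + expR 1).
Proof.
move=> L0 zL.
have /(cvg_cabs _) h :=
  polylim_cvg (@gpart_nneg R) (@gpart_mono R) (@gpart_bnd R) (m := 0) (z := z).
apply: cvgr_to_le h _; apply: nearW => N; rewrite derivn0.
apply: le_trans (cabs_horner_le _ (gpart_nneg _ N)) _.
by rewrite zL; exact: gpart_growth_le.
Qed.

Lemma g_growth_ge k z L : 0 <= L -> 0 <= k -> cabs z = expR L ->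
  (forall a : R, 0 <= a -> expR (- k) * Num.max 1 (a * expR L) <= cabs (1 + ofR a * z)) ->
  expR (L ^+ 2 / 2 - (L + 2) * (k + 1)) <= cabs (gder 0 z).
Proof.
move=> L0 k0 zL hk.
have /(cvg_cabs _) h :=
  polylim_cvg (@gpart_nneg R) (@gpart_mono R) (@gpart_bnd R) (m := 0) (z := z).
apply: cvgr_to_ge h _; near=> N; rewrite derivn0.
apply: pC_gpart_growth_ge => //; near: N; exact: nbhs_infty_ger.
Unshelve. all: by end_near. Qed.
End ProductGrowth.

(** * The characteristic *)

Section Characteristic.
Variable R : realType.
Local Notation C := (CC R).
Local Notation mu := (@lebesgue_measure R).
Implicit Types (L r t x : R) (z : C).

Lemma cabs_polar r t : 0 <= r -> cabs (polar r t) = r.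
Proof.
move=> r0; rewrite cabsE /= !exprMn -mulrDr cos2Dsin2 mulr1.
by rewrite sqrtr_sqr ger0_norm.
Qed.

(** The zeros of [1 + a z] are negative: off a sector around the negative axis,
    there is no cancellation in [1 + a r e^(it)]. *)
Lemma sector_factor_lb (eps : R) : 0 < eps < 1 -> exists2 k : R, 0 <= k &
  forall t r a, `|t| <= (1 - eps) * pi -> 0 <= r -> 0 <= a ->
  expR (- k) * Num.max 1 (a * r) <= cabs (1 + ofR a * polar r t).
Proof.
move=> /andP[e0 e1]; have pi0 := pi_gt0 R.
set d := (1 - eps) * pi.
have d0 : 0 <= d by rewrite mulr_ge0 ?subr_ge0 ?ltW.
have dpi : d < pi by rewrite gtr_pMl // gtrDl oppr_lt0.
have dI : d \in `[0, pi] by rewrite in_itv /= d0 ltW.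
have pI : (pi : R) \in `[0, pi] by rewrite in_itv /= lexx ltW.
pose gam := Num.max 0 (- cos d) : R.
have gam0 : 0 <= gam by rewrite le_max lexx.
have gam1 : gam < 1 by rewrite /gam gt_max ltr01 /= ltrNl -cospi ltr_cos.
(* [1 - 2 gam x + x^2 >= (1 - gam) (1 + x^2)], and [(1 - gam)^2 <= 1 - gam]. *)
exists (- ln (1 - gam)); first by rewrite oppr_ge0 ln_le0 // gerDl oppr_le0.
move=> t r a ht r0 a0.
rewrite opprK lnK ?posrE ?subr_gt0 //.
have ct : - gam <= cos t.
  apply: (@le_trans _ _ (cos d)); first by rewrite lerNl le_max lexx orbT.
  rewrite -(cos_norm t) leNgt; apply/negP.
  rewrite ltr_cos ?in_itv /= ?normr_ge0 ?(le_trans ht (ltW dpi)) ?d0 ?ltW //.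
  by rewrite ltNge ht.
have -> : 1 + ofR a * polar r t = Complex (1 + a * r * cos t) (a * r * sin t).
  by congr Complex; rewrite /=; ring.
rewrite cabsE /=; set x := a * r.
have x0 : 0 <= x by rewrite mulr_ge0.
have m0 : 0 <= Num.max 1 x by rewrite le_max ler01.
rewrite -[leLHS]ger0_norm ?mulr_ge0 ?subr_ge0 ?(ltW gam1) // -sqrtr_sqr ler_wsqrtr //.
have m2 : Num.max 1 x ^+ 2 <= 1 + x ^+ 2.
  by case: (leP 1 x) => _; [rewrite lerDr|rewrite expr1n lerDl sqr_ge0].
have cs := cos2Dsin2 t.
have -> : (1 + x * cos t) ^+ 2 + (x * sin t) ^+ 2 =
    1 + 2 * x * cos t + x ^+ 2 * (cos t ^+ 2 + sin t ^+ 2) by ring.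
rewrite cs mulr1 exprMn.
apply: (@le_trans _ _ ((1 - gam) * (1 + x ^+ 2))).
  apply: ler_pM => //; rewrite ?sqr_ge0 //.
  by rewrite expr2 ler_piMl ?subr_ge0 ?(ltW gam1) // gerBl.
have := sqr_ge0 (x - 1); have := mulr_ge0 x0 (_ : 0 <= cos t + gam).
rewrite -lerBlDr sub0r => /(_ ct); nra.
Qed.

Lemma enorm_gcurve n z : enorm (@gcurve R n) z =
  Num.sqrt (\sum_(j < n) cabs z ^+ j ^+ 2 + cabs (gder 0 z) ^+ 2).
Proof.
rewrite /enorm big_ord_recr /= /gcurve ltnn gprodE; congr (Num.sqrt (_ + _)).
by apply: eq_bigr => j _; rewrite /= ltn_ord cabsX.
Qed.

Section Bounds.
Variable n : nat.
Hypothesis n_gt0 : (1 <= n)%N.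

Let msum r : R := \sum_(j < n) r ^+ j ^+ 2.

Lemma msum_ge1 r : 0 <= r -> 1 <= msum r.
Proof.
rewrite /msum; case: (n) n_gt0 => // m _ r0.
rewrite big_ord_recl expr0 expr1n lerDl; apply: sumr_ge0 => j _.
by rewrite exprn_ge0 // exprn_ge0.
Qed.

Lemma enorm_ge1 z : 1 <= enorm (@gcurve R n) z.
Proof.
rewrite enorm_gcurve -[leLHS]sqrtr1 ler_wsqrtr //.
by apply: le_trans (msum_ge1 (cabs_ge0 z)) _; rewrite lerDl sqr_ge0.
Qed.

Lemma cabs_le_enorm z : cabs (gder 0 z) <= enorm (@gcurve R n) z.
Proof.
rewrite enorm_gcurve -[leLHS]ger0_norm ?cabs_ge0 // -[leLHS]sqrtr_sqr ler_wsqrtr //.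
by rewrite lerDr; apply: sumr_ge0 => j _; rewrite sqr_ge0.
Qed.

Lemma enorm_le z L : 0 <= L -> cabs z = expR L ->
  enorm (@gcurve R n) z <= n.+1%:R * expR (L ^+ 2 / 2 + n.+1%:R * L + expR 1).
Proof.
move=> L0 zL; rewrite enorm_gcurve zL; set M := expR (_ + _ + _).
have M0 : 0 <= M by exact: expR_ge0.
have nL : 0 <= n%:R * L by rewrite mulr_ge0.
have hG : cabs (gder 0 z) <= M.
  apply: le_trans (g_growth_le L0 zL) _; rewrite ler_expR -natr1; nra.
have hj (j : 'I_n) : expR L ^+ j <= M.
  rewrite -expRM_natl ler_expR -[n.+1%:R]natr1.
  have : j%:R * L <= n%:R * L by rewrite ler_wpM2r // ler_nat ltnW.
  by have := expR_ge0 (1 : R); have := sqr_ge0 L; lra.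
rewrite -[leRHS]ger0_norm ?mulr_ge0 // -[leRHS]sqrtr_sqr ler_wsqrtr //.
rewrite exprMn; apply: (@le_trans _ _ (n.+1%:R * M ^+ 2)); last first.
  by rewrite ler_wpM2r ?sqr_ge0 // expr2 ler_peMl // ler1n.
have hsq x : 0 <= x -> x <= M -> x ^+ 2 <= M ^+ 2.
  by move=> x0 xM; rewrite ler_sqr ?nnegrE.
rewrite -natr1 mulrDl mul1r lerD ?hsq ?cabs_ge0 //.
rewrite -[n in n%:R]card_ord mulr_natl -sumr_const; apply: ler_sum => j _.
by rewrite hsq // exprn_ge0 // expR_ge0.
Qed.

Lemma polar_continuous r : continuous (polar r : R -> C).
Proof.
move=> t; apply/cvgC_cabs.
have h : `|r * cos s - r * cos t| + `|r * sin s - r * sin t| @[s --> t] --> 0.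
  rewrite -[X in _ --> X](addr0 0); apply: cvgD; apply: cvg_abs_sub.
    by apply: cvgM; [exact: cvg_cst|exact: continuous_cos].
  by apply: cvgM; [exact: cvg_cst|exact: continuous_sin].
apply: (squeeze_cvgr _ (cvg_cst 0) h).
by apply: nearW => s; rewrite cabs_ge0 /=; exact: cabs_ReIm.
Qed.

Let phi r t := ln (enorm (@gcurve R n) (polar r t)).

Lemma phi_continuous r : 0 <= r -> continuous (phi r).
Proof.
move=> r0 t; have e s : enorm (@gcurve R n) (polar r s) =
    Num.sqrt (msum r + cabs (gder 0 (polar r s)) ^+ 2).
  by rewrite enorm_gcurve cabs_polar.
rewrite /phi; apply: continuous_comp; last first.
  by apply: continuous_ln; apply: lt_le_trans (enorm_ge1 _).
rewrite (_ : (fun s => _) =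
  fun s => Num.sqrt (msum r + cabs (gder 0 (polar r s)) ^+ 2)); last first.
  by apply/funext => s; exact: e.
apply: continuous_comp; last exact: sqrt_continuous.
apply: cvgD; first exact: cvg_cst.
have h : cabs (gder 0 (polar r s)) @[s --> t] --> cabs (gder 0 (polar r t)).
  apply: cvg_cabs; apply: continuous_comp; first exact: polar_continuous.
  exact: (polylim_continuous (@gpart_nneg R) (@gpart_mono R) (@gpart_bnd R)).
by under eq_fun do rewrite expr2; rewrite expr2; apply: cvgM.
Qed.

Lemma phi_integrable r a b : 0 <= r -> mu.-integrable `[a, b] (EFin \o phi r).
Proof.
move=> r0; apply: continuous_compact_integrable; first exact: segment_compact.
by apply: continuous_subspaceT; exact: phi_continuous.
Qed.

Lemma cst_integrable (c a b : R) : mu.-integrable `[a, b] (EFin \o (fun=> c)).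
Proof.
apply: continuous_compact_integrable; first exact: segment_compact.
by apply: continuous_subspaceT => x; exact: cvg_cst.
Qed.

Lemma Rintegral_cst_itv (c a b : R) : a <= b ->
  \int[mu]_(t in `[a, b]) c = c * (b - a).
Proof.
move=> ab; rewrite Rintegral_cst //= lebesgue_measure_itv /= lte_fin.
case: ltP => [_|ba]; first by rewrite -EFinB.
by have -> : b = a; [apply/eqP; rewrite eq_le ab ba|rewrite subrr].
Qed.

Lemma phi_integral_le r : 1 < r ->
  \int[mu]_(t in `[- pi, pi]) phi r t <=
  (ln n.+1%:R + ln r ^+ 2 / 2 + n.+1%:R * ln r + expR 1) * (2 * pi).
Proof.
move=> r1; have r0 : 0 < r := lt_trans ltr01 r1.
have rL : r = expR (ln r) by rewrite lnK.
have pi0 := pi_gt0 R.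
set U := (X in X * _); rewrite (_ : 2 * pi = pi - - pi); last by ring.
rewrite -Rintegral_cst_itv; last by lra.
apply: le_Rintegral => //; [exact/phi_integrable/ltW|exact: cst_integrable|].
move=> t _; rewrite /phi.
have := @enorm_le (polar r t) (ln r) (ln_ge0 (ltW r1)).
rewrite (cabs_polar _ (ltW r0)) => /(_ rL) h.
apply: (@le_trans _ _ (ln (n.+1%:R * expR (ln r ^+ 2 / 2 + n.+1%:R * ln r + expR 1)))).
  rewrite ler_ln ?posrE ?mulr_gt0 ?expR_gt0 ?ltr0n //.
  exact: lt_le_trans (enorm_ge1 _).
by rewrite lnM ?posrE ?expR_gt0 ?ltr0n // expRK /U !addrA.
Qed.

(** The integral is restricted to a sector avoiding the negative axis, which is
    legitimate because the coordinate [1] makes the integrand nonnegative. *)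
Lemma phi_integral_ge eps : 0 < eps < 1 -> exists2 k : R, 0 <= k &
  forall r, 1 < r -> (ln r ^+ 2 / 2 - (ln r + 2) * (k + 1)) * ((1 - eps) * (2 * pi)) <=
  \int[mu]_(t in `[- pi, pi]) phi r t.
Proof.
move=> he; have [k k0 hk] := sector_factor_lb he.
have /andP[e0 e1] := he; have pi0 := pi_gt0 R.
exists k => // r r1; have r0 : 0 < r := lt_trans ltr01 r1.
have rL : r = expR (ln r) by rewrite lnK.
set V := (X in X * _); set d := (1 - eps) * pi.
have d0 : 0 <= d by rewrite mulr_ge0 ?subr_ge0 ?ltW.
have dpi : d <= pi by rewrite ger_pMl // gerDl oppr_le0 ltW.
have -> : (1 - eps) * (2 * pi) = d - - d by rewrite /d; ring.
rewrite -Rintegral_cst_itv; last by lra.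
apply: (@le_trans _ _ (\int[mu]_(t in `[- d, d]) phi r t)).
  apply: le_Rintegral => //; [exact: cst_integrable|exact/phi_integrable/ltW|].
  move=> t; rewrite /= in_itv /= -ler_norml => td.
  have h : expR V <= enorm (@gcurve R n) (polar r t).
    apply: le_trans (cabs_le_enorm _).
    apply: g_growth_ge => //; first exact/ln_ge0/ltW.
      by rewrite (cabs_polar _ (ltW r0)).
    by move=> a a0; rewrite -rL; apply: hk => //; exact: ltW.
  rewrite -[V]expRK ler_ln ?posrE ?expR_gt0 //.
  exact: lt_le_trans (enorm_ge1 _).
rewrite /Rintegral fine_le //.
- by apply: integrable_fin_num => //; exact/phi_integrable/ltW.
- by apply: integrable_fin_num => //; exact/phi_integrable/ltW.
- apply: ge0_subset_integral => //.
  + by have /integrableP[] := phi_integrable (- pi) pi (ltW r0).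
  + by move=> t _; rewrite lee_fin ln_ge0 // enorm_ge1.
  + by move=> t /=; rewrite !in_itv /=; lra.
Qed.

Theorem characteristic_bounds eps : 0 < eps < 1 -> exists B : R, forall r, 1 < r ->
  (1 - eps) * (ln r ^+ 2 / 2) - B * (ln r + 1) <= characteristic (@gcurve R n) r <=
  ln r ^+ 2 / 2 + B * (ln r + 1).
Proof.
move=> he; have [k k0 hk] := phi_integral_ge he.
have /andP[e0 e1] := he; have pi0 := pi_gt0 R.
pose c := `|ln (enorm (@gcurve R n) 0)|.
exists (2 * (k + 1) + `|ln n.+1%:R| + n.+1%:R + expR 1 + c) => r r1.
have L0 := ln_ge0 (ltW r1); set L := ln r in L0 *.
have p2 : 0 < (2 * pi : R) by rewrite mulr_gt0.
have [h1 h2] : (1 - eps) * (L ^+ 2 / 2 - (L + 2) * (k + 1)) <=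
    (2 * pi)^-1 * \int[mu]_(t in `[- pi, pi]) phi r t /\
    (2 * pi)^-1 * \int[mu]_(t in `[- pi, pi]) phi r t <=
    ln n.+1%:R + L ^+ 2 / 2 + n.+1%:R * L + expR 1.
  split.
    rewrite [leRHS]mulrC ler_pdivlMr //; apply: le_trans (hk r r1).
    by rewrite le_eqVlt; apply/orP; left; apply/eqP; rewrite -/L; ring.
  by rewrite [leLHS]mulrC ler_pdivrMr //; exact: phi_integral_le.
rewrite /characteristic -/(phi r).
have c1 : ln (enorm (@gcurve R n) 0) <= c by exact: ler_norm.
have c2 : - c <= ln (enorm (@gcurve R n) 0) by rewrite lerNl /c -normrN ler_norm.
have n1 : ln n.+1%:R <= `|ln n.+1%:R| :> R by exact: ler_norm.
have n2 : 0 <= `|ln n.+1%:R| :> R by exact: normr_ge0.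
have c0 : 0 <= c by exact: normr_ge0.
have E0 := expR_ge0 (1 : R).
have N0 : 0 <= n.+1%:R :> R by [].
apply/andP; split.
  have a1 := mulr_ge0 (ltW e0) (mulr_ge0 (addr_ge0 L0 (ler0n R 2)) (addr_ge0 k0 ler01)).
  have a2 := mulr_ge0 L0 c0; have a3 := mulr_ge0 L0 N0; have a4 := mulr_ge0 L0 E0.
  have a5 := mulr_ge0 L0 n2; have a6 := mulr_ge0 L0 k0.
  nra.
have a2 := mulr_ge0 L0 c0; have a3 := mulr_ge0 L0 N0; have a4 := mulr_ge0 L0 E0.
have a5 := mulr_ge0 L0 n2; have a6 := mulr_ge0 L0 k0.
nra.
Qed.
End Bounds.
End Characteristic.

(** * The curve *)

Section Main.
Variable R : realType.
Local Notation C := (CC R).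
Implicit Types (L r t x : R) (z : C).

Lemma g_zero k : gder 0 (- ofR (expR k.+1%:R) : C) = 0.
Proof.
have [b [_ hb hz _]] := zeros_gder R 0.
have bk : b k = expR k.+1%:R.
  by have := hb k; rewrite addn0 -eq_le => /eqP.
by apply/hz; exists k; rewrite bk.
Qed.

Lemma g_real_growth_ge L : 0 <= L ->
  expR (L ^+ 2 / 2 - (L + 2)) <= cabs (gder 0 (ofR (expR L))).
Proof.
move=> L0; have := @g_growth_ge R 0 (ofR (expR L)) L L0 (lexx 0).
rewrite add0r mulr1 cabs_ofR ger0_norm ?expR_ge0 //; apply=> // a a0.
rewrite oppr0 expR0 mul1r -rmorphM -(rmorph1 (@ofR R)) -rmorphD cabs_ofR.
have x0 : 0 <= a * expR L by rewrite mulr_ge0 // expR_ge0.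
rewrite ger0_norm ?addr_ge0 //.
by rewrite ge_max lerDl x0 lerDr ler01.
Qed.

Lemma gcurve_lt n (j : 'I_n.+1) z : (j < n)%N -> gcurve j z = z ^+ j.
Proof. by rewrite /gcurve => ->. Qed.

Lemma gcurve_max n z : gcurve (ord_max : 'I_n.+1) z = gder 0 z.
Proof. by rewrite /gcurve ltnn gprodE. Qed.

Lemma gcurve_reduced n : (1 <= n)%N -> reduced_representation (@gcurve R n).
Proof.
move=> n1; split=> [j|z].
  rewrite /gcurve; case: ifP => _; [exact: entire_exp|exact: gprod_entire].
by exists ord0; rewrite gcurve_lt // expr0 oner_neq0.
Qed.

(** At the zeros of the product a linear relation reduces to a polynomial of
    degree less than [n], which therefore has too many roots. *)
Lemma gcurve_nondegenerate n : linearly_nondegenerate (@gcurve R n).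
Proof.
move=> c hc.
have split_sum z : \sum_(j < n) c (widen_ord (leqnSn n) j) * z ^+ j + c ord_max * gder 0 z = 0.
  rewrite -[RHS](hc z) big_ord_recr /= gcurve_max; congr (_ + _).
  by apply: eq_bigr => j _; rewrite gcurve_lt /= ?ltn_ord.
pose p : {poly C} := \poly_(j < n) c (inord j).
have pE z : p.[z] = \sum_(j < n) c (widen_ord (leqnSn n) j) * z ^+ j.
  rewrite horner_poly; apply: eq_bigr => j _; congr (c _ * _).
  by apply: val_inj; rewrite /= inordK // ltnW // ltnS ltn_ord.
have p0 : p = 0.
  apply/eqP; apply: contraT => pN0.
  have := @max_poly_roots _ p [seq - ofR (expR k.+1%:R) | k <- iota 0 n] pN0.
  rewrite size_map size_iota ltnNge size_poly; apply.
    apply/allP => z /mapP[k _ ->]; rewrite rootE pE.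
    by have := split_sum (- ofR (expR k.+1%:R)); rewrite g_zero mulr0 addr0 => ->.
  rewrite map_inj_uniq ?iota_uniq // => i k /oppr_inj/(@ofR_inj R)/expR_inj/eqP.
  by rewrite eqr_nat => /eqP[].
have cmax : c ord_max = 0.
  have := split_sum (ofR (expR 0)); rewrite -pE p0 horner0 add0r => /eqP.
  rewrite mulf_eq0 => /orP[/eqP //|/eqP g0].
  have := @g_real_growth_ge 0 (lexx 0); rewrite g0 cabs0 leNgt expR_gt0 //.
move=> j; have [jn|jn] := ltnP j n; last first.
  rewrite -cmax; congr c; apply: val_inj => /=; apply/eqP.
  by rewrite eqn_leq jn -ltnS ltn_ord.
have := congr1 (fun q : {poly C} => q`_j) p0.
by rewrite coef_poly jn coef0 inord_val.
Qed.

Lemma near_infty_expR n (A : R) :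
  \forall N \near \oo, A <= expR (N%:R ^+ 2 / 2 - (N%:R + 2) - n%:R * N%:R) :> R.
Proof.
near=> N.
apply: le_trans (expR_ge1Dx _).
have h1 : 2 * (n%:R + 2) <= N%:R :> R by near: N; exact: nbhs_infty_ger.
have h2 : A + 1 <= N%:R by near: N; exact: nbhs_infty_ger.
have n0 : 0 <= n%:R :> R by [].
have : 0 <= N%:R * (N%:R - 2 * (n%:R + 2)) :> R by rewrite mulr_ge0 // subr_ge0.
nra.
Unshelve. all: by end_near. Qed.

(** A lift [h] at infinity has some [h_j] nonzero at [0]. For the last
    coordinate this contradicts the zeros of the product accumulating at
    infinity, for a monomial it contradicts its superpolynomial growth. *)
Lemma gcurve_transcendental n : transcendental_curve (@gcurve R n).
Proof.
move=> [e [h [e0 hder hnz hext]]].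
(* The limit at [w = 0] is taken along [s e^(-N)], with [s = -1] to meet the
   zeros of the product and [s = 1] to see its growth. *)
have wx (s : C) : cabs s = 1 -> s * ofR (expR (- N%:R)) @[N --> \oo] --> (0 : C).
  move=> s1; apply/cvgC_cabs.
  have -> : (fun N => cabs (s * ofR (expR (- N%:R)) - 0)) = fun N => expR (- N%:R : R).
    by apply/funext => N; rewrite subr0 cabsM s1 mul1r cabs_ofR ger0_norm // expR_ge0.
  apply/cvgrPdist_le => d d0; near=> N.
  rewrite sub0r normrN ger0_norm ?expR_ge0 // expRN -[leRHS]invrK.
  rewrite lef_pV2 ?posrE ?expR_gt0 ?invr_gt0 //; apply: le_trans (expR_ge1Dx _).
  have : d^-1 <= N%:R by near: N; exact: nbhs_infty_ger.
  by lra.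
have near_e (s : C) : cabs s = 1 ->
    \forall N \near \oo, 0 < cabs (s * ofR (expR (- N%:R))) < e.
  move=> s1; near=> N; apply/andP; split.
    by rewrite cabsM s1 mul1r cabs_ofR gtr0_norm expR_gt0.
  by near: N; apply: (cvgr_lt _ (cvg_cabs _ (wx s s1))); rewrite cabs0.
have hcvg j s : cabs s = 1 -> h j (s * ofR (expR (- N%:R))) @[N --> \oo] --> h j 0.
  move=> s1; have c0 : {for 0, continuous (h j)}.
    apply: differentiable_continuous; apply/derivable1_diffP; apply: hder.
    by rewrite cabs0.
  exact: (cvg_comp _ _ (wx s s1) c0).
have invw (s : C) N : (s * ofR (expR (- N%:R)))^-1 = s^-1 * ofR (expR N%:R).
  by rewrite invfM -fmorphV expRN invrK.
have s1 : cabs (1 : C) = 1 := cabs1 R.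
have sN1 : cabs (- 1 : C) = 1 by rewrite cabsN cabs1.
have [j hj0] : exists j, h j 0 != 0 by apply: hnz; rewrite cabs0.
have [jn|jn] := ltnP j n; last first.
  have jmax : j = ord_max.
    by apply: val_inj => /=; apply/eqP; rewrite eqn_leq jn -ltnS ltn_ord.
  have h0 : h j (- 1 * ofR (expR (- N%:R))) @[N --> \oo] --> (0 : C).
    apply: cvg_near_cst; near=> N.
    have /andP[w0 we] : 0 < cabs (- 1 * ofR (expR (- N%:R)) : C) < e.
      by near: N; exact: near_e.
    have [c _ ->] := hext _ w0 we.
    rewrite jmax gcurve_max invw invrN1 mulN1r.
    have N0 : (0 < N)%N by near: N; exact: nbhs_infty_gt.
    by rewrite -(prednK N0) g_zero mulr0.
  by move: hj0; rewrite (cvg_unique _ (hcvg j _ sN1) h0) ?eqxx.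
have cj0 : 0 < cabs (h j 0) by rewrite cabs_gt0.
pose a := cabs (h j 0) / 2.
have a0 : 0 < a by rewrite divr_gt0.
suff : \forall N \near \oo, False by move=> /filter_ex[].
near=> N.
have /andP[w0 we] : 0 < cabs (1 * ofR (expR (- N%:R)) : C) < e.
  by near: N; exact: near_e.
have n1 : a <= cabs (h j (1 * ofR (expR (- N%:R)))).
  near: N; apply: (cvgr_ge _ (cvg_cabs _ (hcvg j _ s1))).
  by rewrite /a ltr_pdivrMr // ltr_pMr // ltr1n.
have n2 : cabs (h ord_max (1 * ofR (expR (- N%:R)))) <= cabs (h ord_max 0) + 1.
  near: N; apply: (cvgr_le _ (cvg_cabs _ (hcvg ord_max _ s1))).
  by rewrite ltrDl.
have n3 : (cabs (h ord_max 0) + 2) / a <=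
    expR (N%:R ^+ 2 / 2 - (N%:R + 2) - j%:R * N%:R).
  by near: N; exact: near_infty_expR.
have [c _ hw] := hext _ w0 we.
move: n1 n2; rewrite !hw gcurve_lt // gcurve_max !cabsM cabsX invw invr1 !mul1r.
rewrite cabs_ofR gtr0_norm ?expR_gt0 // -expRM_natl => n1 n2.
have n4 := g_real_growth_ge (ler0n R N).
have : (cabs (h ord_max 0) + 2) <= cabs c * cabs (gder 0 (ofR (expR N%:R))).
  move: n3; rewrite ler_pdivrMr // => n3; apply: (le_trans n3).
  set q := N%:R ^+ 2 / 2 - (N%:R + 2) in n4 *.
  apply: (@le_trans _ _ (cabs c * expR q)).
    have -> : cabs c * expR q = expR (q - j%:R * N%:R) * (cabs c * expR (j%:R * N%:R)).
      by rewrite mulrCA -expRD subrK.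
    by rewrite ler_pM2l ?expR_gt0.
  by rewrite ler_wpM2l ?cabs_ge0.
lra.
Unshelve. all: by end_near. Qed.

Lemma near_pinfty_ln (A : R) : \forall r \near +oo, A <= ln r /\ 1 < r.
Proof.
near=> r; have r1 : 1 < r by near: r; exact: nbhs_pinfty_gt.
by split=> //; rewrite -ler_expR lnK ?posrE ?(lt_trans ltr01).
Unshelve. all: by end_near. Qed.

(** Both quantities are [(ln r)^2 / 2], up to an arbitrarily small multiple of it
    and a multiple of [ln r]. *)
Lemma N1_characteristic_ratio n : (1 <= n)%N ->
  N1 (@gcurve R n) r / characteristic (@gcurve R n) r @[r --> +oo%R] --> (1 : R).
Proof.
move=> n1; apply/cvgrPdist_le => e0 e00.
pose e := Num.min e0 1.
have e_gt0 : 0 < e by rewrite lt_min e00 ltr01.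
have e_le1 : e <= 1 by rewrite ge_min lexx orbT.
have [|B hB] := characteristic_bounds n1 (eps := e / 4).
  by rewrite divr_gt0 //= ltr_pdivrMr //; lra.
(* [K (ln r + 1)] dominates all error terms of order [ln r] at once. *)
pose K := `|B| + n.+1%:R + `|B| + 1 : R.
have K0 : 0 < K by rewrite ltr_wpDl // !addr_ge0.
near=> r.
have [hL r1] : 8 * K / e + 1 <= ln r /\ 1 < r by near: r; exact: near_pinfty_ln.
have L1 : 1 <= ln r by apply: le_trans hL; rewrite lerDr divr_ge0 ?mulr_ge0 // ltW.
have /andP[T1 T2] := hB r r1.
have /andP[N11 N12] := N1_bounds n r1.
set T := characteristic _ _ in T1 T2 *; set NN := N1 _ _ in N11 N12 *.
set L := ln r in hL L1 T1 T2 N11 N12.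
have KL : K * (L + 1) <= e / 4 * L ^+ 2.
  have : 8 * K <= e * L.
    have : 8 * K / e <= L by apply: le_trans hL; rewrite lerDl.
    by rewrite ler_pdivrMr // [leRHS]mulrC.
  by nra.
have L10 : 0 <= L + 1 by lra.
have BB : B * (L + 1) <= `|B| * (L + 1) by rewrite ler_wpM2r ?ler_norm.
have B0 : 0 <= `|B| * (L + 1) by rewrite mulr_ge0.
have eB : e * (`|B| * (L + 1)) <= `|B| * (L + 1) by rewrite ler_piMl.
have nL : n.+1%:R * L <= n.+1%:R * (L + 1) by rewrite ler_wpM2l // lerDl.
have n0 : 0 <= n.+1%:R * (L + 1) :> R by rewrite mulr_ge0.
have KE : K * (L + 1) = `|B| * (L + 1) + n.+1%:R * (L + 1) + `|B| * (L + 1) + (L + 1).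
  by rewrite /K; ring.
have Q1 : 1 <= L ^+ 2 by rewrite exprn_ege1.
have eQ : e * L ^+ 2 <= L ^+ 2 by rewrite ler_piMl // (le_trans ler01).
have eeQ : e * (e * L ^+ 2) <= e * L ^+ 2.
  by rewrite ler_piMl // mulr_ge0 ?ltW // (lt_le_trans ltr01).
have lowT : (1 - e / 4) * (L ^+ 2 / 2) - `|B| * (L + 1) <= T by lra.
have eT := ler_wpM2l (ltW e_gt0) lowT.
have T0 : 0 < T by lra.
have -> : 1 - NN / T = (T - NN) / T by rewrite mulrBl divff // gt_eqF.
rewrite normrM normfV (gtr0_norm T0) ler_pdivrMr //.
apply: (@le_trans _ _ (e * T)); last first.
  by rewrite ler_wpM2r ?ge_min ?lexx // ltW.
rewrite ler_norml; apply/andP; split; lra.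
Unshelve. all: by end_near. Qed.

(** [T] grows like a power of [ln r], hence slower than every power of [r]. *)
Lemma curve_order_gcurve n : (1 <= n)%N -> curve_order (@gcurve R n) = 0%E.
Proof.
move=> n1; pose f r : \bar R := (ln (characteristic (@gcurve R n) r) / ln r)%:E.
have [|B hB] := characteristic_bounds n1 (eps := 2^-1 : R); first by lra.
have near_f (e : R) : 0 < e -> \forall r \near +oo, (0 <= f r <= e%:E)%E.
  move=> e0; near=> r.
  have [hL r1] : 8 * (1 + `|B|) + 6 * (1 + 2 * `|B|) / e ^+ 3 <= ln r /\ 1 < r.
    by near: r; exact: near_pinfty_ln.
  have /andP[T1 T2] := hB r r1.
  set T := characteristic _ _ in T1 T2; set L := ln r in hL T1 T2.
  have b0 : 0 <= `|B| by exact: normr_ge0.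
  have b1 := ler_norm B.
  have b2 : - `|B| <= B by rewrite lerNl -normrN ler_norm.
  have q0 : 0 <= 6 * (1 + 2 * `|B|) / e ^+ 3.
    by rewrite mulr_ge0 ?invr_ge0 ?exprn_ge0 ?(ltW e0) //; lra.
  have L8 : 8 * (1 + `|B|) <= L by apply: le_trans hL; rewrite lerDl.
  have LE : 6 * (1 + 2 * `|B|) <= e ^+ 3 * L.
    rewrite [leRHS]mulrC -ler_pdivrMr ?exprn_gt0 //; apply: (le_trans _ hL).
    by rewrite lerDr mulr_ge0 // addr_ge0.
  have L1 : 1 <= L by lra.
  have T1' : 1 <= T by nra.
  have T2' : T <= (1 + 2 * `|B|) * L ^+ 2 by nra.
  have TE : T <= expR (e * L).
    have eL0 : 0 <= e * L by rewrite mulr_ge0 ?ltW //; lra.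
    (* [x^3 / 6 <= expR x] with [x = e ln r] outgrows the square of [ln r]. *)
    have := expR_ge1Dxn 2 eL0; rewrite -[3`!]/6%N => h; apply: le_trans h.
    apply: (le_trans T2'); rewrite exprMn ler_wpDl // ler_pdivlMr //.
    have := ler_wpM2r (sqr_ge0 L) LE; lra.
  have L0 : 0 < L by lra.
  have TP : 0 < T by lra.
  rewrite /f !lee_fin -/T -/L; apply/andP; split.
    by rewrite divr_ge0 ?ln_ge0 // ltW.
  by rewrite ler_pdivrMr // -ler_expR lnK ?posrE.
rewrite /curve_order limf_esupE -/f; apply/eqP; rewrite eq_le; apply/andP; split.
  apply/lee_addgt0Pr => e e0; rewrite add0e.
  apply: (@le_trans _ _ (ereal_sup (f @` [set r | (0 <= f r <= e%:E)%E]))).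
    apply: ereal_inf_lbound.
    by exists [set r | (0 <= f r <= e%:E)%E] => //; exact: near_f.
  by apply: ge_ereal_sup => _ [r /= /andP[_ h] <-].
apply: le_ereal_inf_tmp => _ [V FV <-].
have /filter_ex[r [Vr /andP[fr _]]] : \forall r \near +oo, V r /\ (0 <= f r <= 1%:E)%E.
  by apply: filterI => //; exact: near_f.
by apply: le_trans fr _; apply: ereal_sup_ubound; exists r.
Unshelve. all: by end_near. Qed.
End Main.

Theorem proposition8p3 (R : realType) (n : nat) (hn : (1 <= n)%N) :
  [/\ reduced_representation (@gcurve R n),
      transcendental_curve (@gcurve R n),
      linearly_nondegenerate (@gcurve R n),
      curve_order (@gcurve R n) = 0%E
    & N1 (@gcurve R n) r / characteristic (@gcurve R n) r
        @[r --> +oo%R] --> (1 : R)].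
Proof.
split.
- exact: gcurve_reduced.
- exact: gcurve_transcendental.
- exact: gcurve_nondegenerate.
- exact: curve_order_gcurve.
- exact: N1_characteristic_ratio.
Qed.
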